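(* Let $n\geq 1$ be an integer, let $G$ be a group of type $FP_n$, let $N\leq G$ be a subgroup of type $FP_n$ that is subnormal in $G$, and let $\chi: G\to\mathbb{R}$ be a character. If $[\chi|_N]\in\Sigma^n(N,\mathbb{Z})$ (in particular $\chi|_N \neq 0$), then $[\chi]\in\Sigma^n(G,\mathbb{Z})$.
   Context: A subgroup $N\leq G$ is subnormal if there is a finite chain $N=N_0\leq N_1\leq\cdots\leq N_r=G$ with $N_i$ normal in $N_{i+1}$ for all $i$ (no finiteness condition is imposed on the intermediate $N_i$). For an associative ring $R$, an $R$-module $A$ is of type $FP_n$ over $R$ if it has a projective resolution over $R$ in which all projectives in dimensions $\leq n$ are finitely generated; a group $G$ is of type $FP_n$ if the trivial $\mathbb{Z}G$-module $\mathbb{Z}$ is of type $FP_n$ over $\mathbb{Z}G$. Modules are left modules. A character of a group $G$ is a non-zero group homomorphism $\chi: G \to \mathbb{R}$. For a finitely generated group $G$, the character sphere $S(G)$ is the set of classes $[\chi]$ of characters of $G$, where two characters are equivalent if one is a positive real multiple of the other. Put $G_\chi = \{g \in G \mid \chi(g) \geq 0\}$ (a submonoid of $G$). Then $\Sigma^n(G,\mathbb{Z}) = \{[\chi] \in S(G) \mid \text{the trivial module } \mathbb{Z} \text{ is of type } FP_n \text{ over the monoid ring } \mathbb{Z}G_\chi\}$. *)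

(* Defs.v *)
From HB Require Import structures.
From mathcomp Require Import all_boot all_order all_algebra.
From mathcomp Require Import finmap monalg.
From mathcomp Require Import boolp classical_sets reals.

Set Implicit Arguments.
Unset Strict Implicit.
Unset Printing Implicit Defensive.

Import Order.TTheory GRing.Theory Num.Theory.

Local Open Scope ring_scope.

(* [monalg] equips [{malg R[K]}] with a product only when [K] is a
   [monomType], whose axioms force 1 to be the only invertible element, which
   excludes groups.  Hence the alias below, carrying the convolution product
   of an arbitrary monoid. *)
Definition monoid_ring (M : monoidType) := {malg int[M]}.

HB.instance Definition _ (M : monoidType) :=
  GRing.Zmodule.copy (monoid_ring M) {malg int[M]}.

Section MonoidRing.
Variable M : monoidType.
Implicit Types a b c : {malg int[M]}.

Definition mring_one : {malg int[M]} := << (1%g : M) >>.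

Definition mring_mul a b : {malg int[M]} :=
  \sum_(k <- msupp a) \sum_(l <- msupp b) << a@_k * b@_l *g (k * l)%g >>.

Local Open Scope fset_scope.
Local Open Scope ring_scope.

Lemma mring_mullw (d1 d2 : {fset M}) a b :
  msupp a `<=` d1 -> msupp b `<=` d2 ->
  mring_mul a b = \sum_(k <- d1) \sum_(l <- d2) << a@_k * b@_l *g (k * l)%g >>.
Proof.
move=> le_d1 le_d2; rewrite /mring_mul (big_fset_incl _ le_d1) /=.
  apply/eq_bigr=> k1 _; apply/big_fset_incl => // k _ /mcoeff_outdom ->.
  by rewrite mulr0 monalgU0.
move=> k _ /mcoeff_outdom ak.
by rewrite big1 => // k' _; rewrite ak mul0r monalgU0.
Qed.

Lemma mring_mul0g : left_zero 0 mring_mul.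
Proof. by move=> a; rewrite /mring_mul msupp0 big_seq_fset0. Qed.

Lemma mring_mulg0 : right_zero 0 mring_mul.
Proof.
by move=> a; rewrite /mring_mul msupp0 big1 // => k _; rewrite big_seq_fset0.
Qed.

Lemma mring_mulDl : left_distributive mring_mul +%R.
Proof.
move=> a b c.
rewrite (mring_mullw (msuppD_le a b) (fsubset_refl (msupp c))).
rewrite (mring_mullw (fsubsetUl (msupp a) (msupp b)) (fsubset_refl (msupp c))).
rewrite (mring_mullw (fsubsetUr (msupp a) (msupp b)) (fsubset_refl (msupp c))).
rewrite -big_split /=; apply/eq_bigr=> k _.
rewrite -big_split /=; apply/eq_bigr=> l _.
by rewrite mcoeffD mulrDl monalgUD.
Qed.

Lemma mring_mulDr : right_distributive mring_mul +%R.
Proof.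
move=> c a b.
rewrite (mring_mullw (fsubset_refl (msupp c)) (msuppD_le a b)).
rewrite (mring_mullw (fsubset_refl (msupp c)) (fsubsetUl (msupp a) (msupp b))).
rewrite (mring_mullw (fsubset_refl (msupp c)) (fsubsetUr (msupp a) (msupp b))).
rewrite -big_split /=; apply/eq_bigr=> k _.
rewrite -big_split /=; apply/eq_bigr=> l _.
by rewrite mcoeffD mulrDr monalgUD.
Qed.

Lemma mring_mulUU (x y : int) (k l : M) :
  mring_mul << x *g k >> << y *g l >> = << x * y *g (k * l)%g >>.
Proof. by rewrite (mring_mullw msuppU_le msuppU_le) !big_seq_fset1 !mcoeffUU. Qed.

Lemma mring_mul_suml (I : Type) (r : seq I) (F : I -> {malg int[M]}) b :
  mring_mul (\sum_(i <- r) F i) b = \sum_(i <- r) mring_mul (F i) b.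
Proof.
exact: (big_morph (mring_mul^~ b) (fun x y => mring_mulDl x y b) (mring_mul0g b)).
Qed.

Lemma mring_mul_sumr (I : Type) (r : seq I) (F : I -> {malg int[M]}) a :
  mring_mul a (\sum_(i <- r) F i) = \sum_(i <- r) mring_mul a (F i).
Proof. exact: (big_morph (mring_mul a) (mring_mulDr a) (mring_mulg0 a)). Qed.

Lemma mring_mul1g : left_id mring_one mring_mul.
Proof.
move=> a; rewrite [a]monalgE mring_mul_sumr; apply/eq_bigr => k _.
by rewrite mring_mulUU mul1r mul1g.
Qed.

Lemma mring_mulg1 : right_id mring_one mring_mul.
Proof.
move=> a; rewrite [a]monalgE mring_mul_suml; apply/eq_bigr => k _.
by rewrite mring_mulUU mulr1 mulg1.
Qed.

Lemma mring_mulA : associative mring_mul.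
Proof.
move=> a b c; rewrite [a]monalgE !mring_mul_suml; apply/eq_bigr => k _.
rewrite [b]monalgE mring_mul_sumr !mring_mul_suml mring_mul_sumr.
apply/eq_bigr => l _; rewrite [c]monalgE !mring_mul_sumr.
by apply/eq_bigr => m _; rewrite !mring_mulUU mulrA mulgA.
Qed.

Lemma mring_one_neq0 : mring_one != 0.
Proof. by rewrite monalgU_eq0. Qed.

Definition augmentation a : int := \sum_(k <- msupp a) a@_k.

Lemma augmentationEw (d : {fset M}) a :
  msupp a `<=` d -> augmentation a = \sum_(k <- d) a@_k.
Proof. by move=> le_d; apply/big_fset_incl => // k _ /mcoeff_outdom. Qed.

Lemma augmentationD a b : augmentation (a + b) = augmentation a + augmentation b.
Proof.
rewrite (augmentationEw (msuppD_le a b)) (augmentationEw (fsubsetUl _ (msupp b))).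
rewrite (augmentationEw (fsubsetUr (msupp a) _)) -big_split /=.
by apply/eq_bigr => k _; rewrite mcoeffD.
Qed.

Lemma augmentation0 : augmentation 0 = 0.
Proof. by rewrite /augmentation msupp0 big_seq_fset0. Qed.

Lemma augmentationU (x : int) (k : M) : augmentation << x *g k >> = x.
Proof. by rewrite (augmentationEw msuppU_le) big_seq_fset1 mcoeffUU. Qed.

Lemma augmentation_sum (I : Type) (r : seq I) (F : I -> {malg int[M]}) :
  augmentation (\sum_(i <- r) F i) = \sum_(i <- r) augmentation (F i).
Proof. exact: (big_morph augmentation augmentationD augmentation0). Qed.

Lemma augmentationM a b :
  augmentation (mring_mul a b) = augmentation a * augmentation b.
Proof.
rewrite augmentation_sum mulr_suml; apply/eq_bigr => k _.
rewrite augmentation_sum mulr_sumr; apply/eq_bigr => l _.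
by rewrite augmentationU.
Qed.

Lemma augmentation1 : augmentation mring_one = 1.
Proof. exact: augmentationU. Qed.

End MonoidRing.

HB.instance Definition _ (M : monoidType) :=
  GRing.Zmodule_isNzRing.Build (monoid_ring M)
    (@mring_mulA M) (@mring_mul1g M) (@mring_mulg1 M)
    (@mring_mulDl M) (@mring_mulDr M) (@mring_one_neq0 M).

(* [a] acts on Z through its augmentation, so that each basis element
   [<< k >>], [k : M], acts as the identity. *)
Definition trivial_module (M : monoidType) := int.

HB.instance Definition _ (M : monoidType) :=
  GRing.Zmodule.copy (trivial_module M) int.

Section TrivialModule.
Variable M : monoidType.

Definition trivial_scale (a : monoid_ring M) (z : trivial_module M) :
  trivial_module M := augmentation a * z.

Lemma trivial_scaleA a b z :
  trivial_scale a (trivial_scale b z) = trivial_scale (a * b) z.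
Proof. by rewrite /trivial_scale augmentationM mulrA. Qed.

Lemma trivial_scale1 : left_id 1 trivial_scale.
Proof. by move=> z; rewrite /trivial_scale augmentation1 mul1r. Qed.

Lemma trivial_scaleDr : right_distributive trivial_scale +%R.
Proof. by move=> a x y; apply: mulrDr. Qed.

Lemma trivial_scaleDl z : {morph trivial_scale^~ z : a b / a + b}.
Proof. by move=> a b; rewrite /trivial_scale augmentationD mulrDl. Qed.

HB.instance Definition _ :=
  GRing.Zmodule_isLmodule.Build (monoid_ring M) (trivial_module M)
    trivial_scaleA trivial_scale1 trivial_scaleDr trivial_scaleDl.

End TrivialModule.

Section Finiteness.
Variable R : pzRingType.

Definition fin_generated (A : lmodType R) : Prop :=
  exists (k : nat) (e : 'I_k -> A),
    forall x : A, exists c : 'I_k -> R, x = \sum_(i < k) c i *: e i.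

Definition projective (P : lmodType R) : Prop :=
  forall (B C : lmodType R) (g : {linear B -> C}) (f : {linear P -> C}),
    (forall c, exists b, g b = c) ->
    exists h : {linear P -> B}, forall x, g (h x) = f x.

Record proj_resolution (A : lmodType R) := ProjResolution {
  res_obj :> nat -> lmodType R;
  res_diff : forall i, {linear res_obj i.+1 -> res_obj i};
  res_aug : {linear res_obj 0 -> A};
  res_proj : forall i, projective (res_obj i);
  res_aug_surj : forall x, exists y, res_aug y = x;
  res_exact0 : forall y, res_aug y = 0 <-> exists z, res_diff 0 z = y;
  res_exactS : forall i y,
    res_diff i y = 0 <-> exists z, res_diff i.+1 z = y }.

Definition type_FP (n : nat) (A : lmodType R) : Prop :=
  exists P : proj_resolution A, forall i, (i <= n)%N -> fin_generated (P i).

End Finiteness.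

(* For a group [G], this is "[G] is of type FP_n". *)
Definition monoid_type_FP (n : nat) (M : monoidType) : Prop :=
  type_FP n (trivial_module M : lmodType (monoid_ring M)).

(* Subgroups are boolean predicates closed under the group operations; with
   the classical axioms of [boolp] every subgroup is of this form. *)
Section Subgroups.
Variable G : groupType.
Implicit Types H K N : groupClosed G.

Definition subgroup N := {x : G | x \in N}.

Definition normal_in H K : Prop :=
  {subset H <= K} /\ {in H & K, forall x y, (x ^ y)%g \in H}.

Definition subnormal N : Prop :=
  exists (r : nat) (C : nat -> groupClosed G),
    [/\ C 0%N =i N, C r =i predT &
        forall i, (i < r)%N -> normal_in (C i) (C i.+1)].

End Subgroups.

Section SubgroupType.
Variables (G : groupType) (N : groupClosed G).

Lemma subgroup_closed : group_closed (fun x : G => x \in N).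
Proof. by split=> [|x y Nx Ny]; [exact: gpred1 | exact: gpredF]. Qed.

HB.instance Definition _ := [Choice of subgroup N by <:].
HB.instance Definition _ := SubChoice.on (subgroup N).
HB.instance Definition _ :=
  SubChoice_isSubGroup.Build G (fun x : G => x \in N) (subgroup N)
    subgroup_closed.

End SubgroupType.

(* The zero homomorphism is included, so that restriction to a subgroup is
   always defined; characters are those satisfying [is_character]. *)
Record real_hom (R : realType) (G : groupType) := RealHom {
  real_hom_fun :> G -> R;
  real_homM : {morph real_hom_fun : x y / (x * y)%g >-> x + y} }.

Section Characters.
Variables (R : realType) (G : groupType).
Implicit Types chi psi : real_hom R G.

Definition is_character chi : Prop := exists g, chi g != 0.

Lemma real_hom1 chi : chi 1%g = 0.
Proof. by apply: (addrI (chi 1%g)); rewrite -real_homM mulg1 addr0. Qed.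

Lemma restrict_subproof (N : groupClosed G) chi :
  {morph (fun x : subgroup N => chi (val x)) : x y / (x * y)%g >-> x + y}.
Proof. by move=> x y; rewrite valM real_homM. Qed.

Definition restrict (N : groupClosed G) chi : real_hom R (subgroup N) :=
  RealHom (restrict_subproof chi).

Definition nonneg_monoid chi := {g : G | 0 <= chi g}.

Lemma nonneg_monoid_closed chi : monoid_closed (fun g : G => 0 <= chi g).
Proof.
split=> [|x y]; rewrite !unfold_in ?real_hom1 // => x0 y0.
by rewrite real_homM addr_ge0.
Qed.

HB.instance Definition _ chi := [Choice of nonneg_monoid chi by <:].
HB.instance Definition _ chi := SubChoice.on (nonneg_monoid chi).
HB.instance Definition _ chi :=
  SubChoice_isSubMonoid.Build G (fun g : G => 0 <= chi g) (nonneg_monoid chi)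
    (nonneg_monoid_closed chi).

Local Open Scope classical_set_scope.

Definition char_class chi : set (real_hom R G) :=
  [set psi | exists2 c : R, 0 < c & forall g, psi g = c * chi g].

Definition character_sphere : set (set (real_hom R G)) :=
  [set char_class chi | chi in is_character].

Definition Sigma (n : nat) : set (set (real_hom R G)) :=
  [set char_class chi | chi in
    [set chi | is_character chi /\ monoid_type_FP n (nonneg_monoid chi)]].

Lemma Sigma_sub_sphere n : Sigma n `<=` character_sphere.
Proof. by move=> _ [chi [chi_neq0 _] <-]; exists chi. Qed.

End Characters.

(* Main.v *)
From mathcomp Require Import all_boot all_order all_algebra.
From HB Require Import structures.
From mathcomp Require Import finmap monalg.
From mathcomp Require Import boolp functions reals.
Require Import Defs.

(** The Sigma condition for [N] is a vanishing statement for the cohomology of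
    [N] with certain coefficients; such a vanishing climbs a subnormal chain by
    the argument behind the Lyndon-Hochschild-Serre spectral sequence, valid for
    arbitrary intermediate groups; and at the top of the chain, where [G] is of
    type FP_n, the vanishing can be turned back into the Sigma condition.

    The coefficients are the [complete] modules: the modules [A] over [Z[G]]
    such that [1 - T] is invertible on [A ^ k] for each square matrix [T] whose
    entries are supported where [chi > 0].

    From the Sigma condition to vanishing.  Let [Q] be a free resolution of [Z]
    over [S = Z[N_chi]], finitely generated up to degree [n], and let [t] in
    [N] have [chi t > 0].  Multiplication by [t] is an isomorphism from [Q],
    twisted by conjugation by [t], onto the subcomplex [t Q]; hence the identity
    of [Z] lifts to a chain endomorphism [phi] of [Q] with values in [t Q]
    ([twisted_endomorphism]).  After extension of scalars to [Z[N]], the map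
    [1 - phi] is null-homotopic, because it lifts zero, and yet acts invertibly
    on the cochains [Hom_N (Q_i, A)] with [A] complete and [i <= n].  So these
    cochain complexes are contractible up to degree [n], by additive maps that
    are natural in [A] ([base_contraction]).  By comparison the same is true of
    [Hom_N (F_i, A)], for [F] a free resolution of [Z] over [Z[G]].

    From [N] to [K], when [N] is normal in [K].  The group [K] acts by
    conjugation on [Hom_N (F_i, A)], and its invariants are [Hom_K (F_i, A)].
    As [F_i] is free over [Z[K]], an operator into [Hom_N (F_i, A)] may be
    replaced by a conjugate of itself chosen separately on each coset, which
    makes it [K]-equivariant ([average]).  Correcting the contraction degree by
    degree keeps it a contraction, and an equivariant contraction restricts to
    the invariants ([averaged_contraction]).

    From vanishing back to finiteness.  Filter [F] by a valuation [v] extending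
    [chi] for which the differential does not lower [v].  The module of all
    sequences in [F_i] modulo the sequences tending to infinity is complete
    ([completion_complete]): modulo null sequences, [1 - T] is inverted by long
    partial sums of its geometric series.  The constant sequences form a chain
    map from [F] to these completions; naturality of the contraction makes this
    chain map null-homotopic up to degree [n], and as [F_i] is finitely
    generated for [i <= n], a late term of the sequences in question gives maps
    [h : F_i -> F_(i+1)] such that [1 - d h - h d] raises [v] by at least [1]
    ([contracting_homotopy]).  Therefore the boundary of [w] is also the
    boundary of [w - d h w], whose valuation is larger unless it is already
    bounded below in terms of that of [d w]; iterating, a cycle of [F] bounds a
    chain whose valuation is lower by at most a constant ([bounding]).  The
    submodules [v >= - c * chi t] of [F], for natural numbers [c], are free over
    [Z[G_chi]], and finitely generated up to degree [n], so the last property is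
    the hypothesis of Brown's criterion ([syzygies_fin_generated]) for [Z] to be of type FP_n over
    [Z[G_chi]]. *)

Set Implicit Arguments.
Unset Strict Implicit.
Unset Printing Implicit Defensive.

Import Order.TTheory GRing.Theory Num.Theory.

Local Open Scope ring_scope.

(** * Linear maps, spans and submodules *)

Section LinearMaps.
Variable R : pzRingType.
Implicit Types A B C D : lmodType R.

Definition to_linear A B (f : A -> B) (f_lin : linear f) : {linear A -> B} :=
  HB.pack f (GRing.isLinear.Build R A B *:%R f f_lin).

Lemma to_linearE A B (f : A -> B) (f_lin : linear f) x :
  to_linear f_lin x = f x.
Proof. by []. Qed.

Lemma linear_comp A B C (f : {linear A -> B}) (g : {linear B -> C}) :
  exists h : {linear A -> C}, forall x, h x = g (f x).
Proof.
have gf_lin : linear (g \o f) by move=> a x y; rewrite /= !linearP.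
by exists (to_linear gf_lin).
Qed.

Lemma linear_add A B (f g : {linear A -> B}) :
  exists h : {linear A -> B}, forall x, h x = f x + g x.
Proof.
have h_lin : linear (fun x => f x + g x).
  by move=> a x y; rewrite !linearP scalerDr addrACA.
by exists (to_linear h_lin).
Qed.

Lemma linear_sub A B (f g : {linear A -> B}) :
  exists h : {linear A -> B}, forall x, h x = f x - g x.
Proof.
have h_lin : linear (fun x => f x - g x).
  by move=> a x y; rewrite (linearP f) (linearP g) scalerBr opprD addrACA.
by exists (to_linear h_lin).
Qed.

Lemma linear_id A : exists h : {linear A -> A}, forall x, h x = x.
Proof.
have h_lin : linear (fun x : A => x) by [].
by exists (to_linear h_lin).
Qed.

(** The factorization is unique, hence linear, because [j] is injective. *)
Lemma factor_injective A B C (j : {linear B -> C}) (f : {linear A -> C}) :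
  injective j -> (forall x, exists y, j y = f x) ->
  exists h : {linear A -> B}, forall x, j (h x) = f x.
Proof.
move=> j_inj /choice[h hE].
have h_lin : linear h.
  by move=> a x y; apply: j_inj; rewrite linearP !hE linearP.
by exists (to_linear h_lin).
Qed.

(** An inductive span avoids explicit coefficient families, so that closure
    under sums, scalars and linear maps is by induction. *)
Inductive in_span A (s : seq A) : A -> Prop :=
| Span0 : in_span s 0
| SpanD a x y : x \in s -> in_span s y -> in_span s (a *: x + y).

Lemma in_spanD A (s : seq A) x y :
  in_span s x -> in_span s y -> in_span s (x + y).
Proof.
move=> sx sy; elim: sx => [|a u v us _ IH]; first by rewrite add0r.
by rewrite -addrA; apply: SpanD.
Qed.

Lemma in_spanZ A (s : seq A) a x : in_span s x -> in_span s (a *: x).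
Proof.
elim=> [|b u v us _ IH]; first by rewrite scaler0; exact: Span0.
by rewrite scalerDr scalerA; apply: SpanD.
Qed.

Lemma in_span_mem A (s : seq A) x : x \in s -> in_span s x.
Proof.
by move=> xs; rewrite -[x]addr0 -[x]scale1r; apply: SpanD (Span0 s).
Qed.

Lemma in_span_sum A (s : seq A) (I : Type) (r : seq I) (F : I -> A) :
  (forall i, in_span s (F i)) -> in_span s (\sum_(i <- r) F i).
Proof.
move=> sF; elim/big_ind: _ => //; first exact: Span0.
exact: in_spanD.
Qed.

Lemma in_span_map A B (f : {linear A -> B}) (s : seq A) (s' : seq B) x :
  {subset map f s <= s'} -> in_span s x -> in_span s' (f x).
Proof.
move=> ss'; elim=> [|a u v us _ IH]; first by rewrite linear0; exact: Span0.
by rewrite linearP; apply: SpanD IH; apply/ss'/map_f.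
Qed.

Lemma fin_generatedP A :
  fin_generated A <-> exists s : seq A, forall x, in_span s x.
Proof.
split=> [[k [e eP]]|[s sP]].
  exists [seq e i | i : 'I_k] => x; have [c ->] := eP x.
  apply: in_span_sum => i; apply/in_spanZ/in_span_mem.
  by apply/map_f; rewrite mem_enum.
exists (size s), (fun i => tnth (in_tuple s) i) => x.
elim: (sP x) => [|a u v us _ [c ->]].
  by exists (fun=> 0); rewrite big1 // => i _; rewrite scale0r.
have /seq_tnthP[j ->] := us.
exists (fun i => (if i == j then a else 0) + c i).
rewrite [in RHS](eq_bigr (fun i : 'I_(size s) =>
  (if i == j then a else 0) *: tnth (in_tuple s) i +
  c i *: tnth (in_tuple s) i)); last by move=> i _; rewrite scalerDl.
rewrite big_split /=; congr (_ + _).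
rewrite (bigD1 j) //= eqxx big1 ?addr0 // => i /negPf ->.
by rewrite scale0r.
Qed.

Lemma fin_generated_cover A B D (u : {linear A -> D}) (v : {linear B -> D}) :
  fin_generated A -> fin_generated B ->
  (forall y, exists a b, y = u a + v b) -> fin_generated D.
Proof.
move=> /fin_generatedP[s sP] /fin_generatedP[s' s'P] uvP.
apply/fin_generatedP; exists (map u s ++ map v s') => y.
have [a [b ->]] := uvP y.
by apply: in_spanD; [apply: in_span_map (sP a)|apply: in_span_map (s'P b)] => z;
   rewrite mem_cat => ->; rewrite ?orbT.
Qed.

Lemma fin_generated_surj A D (u : {linear A -> D}) :
  fin_generated A -> (forall y, exists a, u a = y) -> fin_generated D.
Proof.
move=> fgA uP; apply: (fin_generated_cover (u := u) (v := u) fgA fgA) => y.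
by have [a <-] := uP y; exists a, 0; rewrite linear0 addr0.
Qed.

Definition is_submodule A (S : A -> Prop) : Prop :=
  S 0 /\ forall a x y, S x -> S y -> S (a *: x + y).

Section Submodule.
Variables (A : lmodType R) (S : A -> Prop) (S_sub : is_submodule S).

Definition submod_pred of is_submodule S : pred A := fun x => `[<S x>].
Definition submod (S_sub : is_submodule S) := {x : A | submod_pred S_sub x}.

Lemma submod_pred_closed : submod_closed (submod_pred S_sub).
Proof.
have [S0 SD] := S_sub.
split; first exact/asboolP.
by move=> a x y /asboolP Sx /asboolP Sy; apply/asboolP/SD.
Qed.

HB.instance Definition _ := [Choice of submod S_sub by <:].
HB.instance Definition _ := SubChoice.on (submod S_sub).
HB.instance Definition _ :=
  GRing.SubChoice_isSubLmodule.Build R A (submod_pred S_sub) (submod S_sub)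
    submod_pred_closed.

Definition submod_val : {linear submod S_sub -> A} := val.

Lemma submodP (x : submod S_sub) : S (submod_val x).
Proof. exact/asboolP/(valP x). Qed.

Lemma submod_onto x : S x -> exists y, submod_val y = x.
Proof. by move=> Sx; exists (exist _ x (asboolT Sx)). Qed.

Lemma submod_val_inj : injective submod_val.
Proof. exact: val_inj. Qed.

End Submodule.

Lemma ker_submodule A B (f : {linear A -> B}) :
  is_submodule (fun x => f x = 0).
Proof.
by split=> [|a x y fx fy]; rewrite ?linear0 // linearP fx fy scaler0 addr0.
Qed.

Lemma im_submodule A B (f : {linear A -> B}) :
  is_submodule (fun y => exists x, f x = y).
Proof.
split=> [|a _ _ [x <-] [y <-]]; first by exists 0; rewrite linear0.
by exists (a *: x + y); rewrite linearP.
Qed.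

(** The definition of projectivity lifts through surjections only; applied to
    the corestriction of [g] to its image it lifts through any [g]. *)
Lemma projective_lift (P : lmodType R) B C (g : {linear B -> C})
    (f : {linear P -> C}) :
  projective P -> (forall x, exists b, g b = f x) ->
  exists h : {linear P -> B}, forall x, g (h x) = f x.
Proof.
move=> P_proj gf; pose I := submod (im_submodule g).
pose j : {linear I -> C} := submod_val (im_submodule g).
have j_inj : injective j by apply: submod_val_inj.
have [f' f'E] : exists f' : {linear P -> I}, forall x, j (f' x) = f x.
  apply: factor_injective => // x.
  by have := gf x => /(submod_onto (im_submodule g)).
have [g' g'E] : exists g' : {linear B -> I}, forall x, j (g' x) = g x.
  apply: factor_injective => // x.
  by apply: (submod_onto (im_submodule g)); exists x.
have [|h hE] := P_proj _ _ g' f'.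
  move=> c; have [b bE] := submodP c.
  by exists b; apply: j_inj; rewrite g'E.
by exists h => x; rewrite -g'E hE f'E.
Qed.

End LinearMaps.

Arguments to_linear : simpl never.

(** * Modules over a monoid ring *)

Section FreeAbelian.
Variables (K : choiceType) (V : zmodType).
Implicit Types (f : K -> V) (v w : {malg int[K]}).

Definition ext_int f v : V := \sum_(k <- msupp v) f k *~ v@_k.

Lemma ext_intEw (d : {fset K}) f v : (msupp v `<=` d)%fset ->
  ext_int f v = \sum_(k <- d) f k *~ v@_k.
Proof.
by move=> le_d; apply/big_fset_incl => // k _ /mcoeff_outdom ->; rewrite mulr0z.
Qed.

Lemma ext_intB f : {morph ext_int f : v w / v - w}.
Proof.
move=> v w.
rewrite (ext_intEw _ (msuppB_le v w)) (ext_intEw _ (fsubsetUl _ (msupp w))).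
rewrite (ext_intEw _ (fsubsetUr (msupp v) _)) -sumrB.
by apply/eq_bigr => k _; rewrite mcoeffB mulrzBr.
Qed.

Lemma ext_intU f k : ext_int f << k >> = f k.
Proof. by rewrite (ext_intEw _ msuppU_le) big_seq_fset1 mcoeffUU. Qed.

Lemma malg_intE v : v = \sum_(k <- msupp v) << k >> *~ v@_k.
Proof.
rewrite {1}[v]monalgE; apply/eq_bigr => k _.
by rewrite -[LHS]/(mkmalgU k _) -[v@_k in LHS]intz raddfMz.
Qed.

End FreeAbelian.

Section AdditiveMaps.
Variables U V : zmodType.

Definition to_additive (f : U -> V) (fB : {morph f : x y / x - y}) :
  {additive U -> V} := HB.pack f (GRing.isZmodMorphism.Build U V f fB).

Lemma morphB_sum (f : U -> V) (I : Type) (r : seq I) (F : I -> U) :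
  {morph f : x y / x - y} -> f (\sum_(i <- r) F i) = \sum_(i <- r) f (F i).
Proof. by move=> fB; apply: (raddf_sum (to_additive fB)). Qed.

Lemma morphB_Mz (f : U -> V) x z :
  {morph f : x y / x - y} -> f (x *~ z) = f x *~ z.
Proof. by move=> fB; apply: (raddfMz (to_additive fB)). Qed.

Lemma morphB_0 (f : U -> V) : {morph f : x y / x - y} -> f 0 = 0.
Proof. by move=> fB; apply: (raddf0 (to_additive fB)). Qed.

Lemma morphB_D (f : U -> V) :
  {morph f : x y / x - y} -> {morph f : x y / x + y}.
Proof. by move=> fB; apply: (raddfD (to_additive fB)). Qed.

End AdditiveMaps.

Lemma ext_int_uniq (K : choiceType) (V : zmodType) (f g : {malg int[K]} -> V) :
  {morph f : x y / x - y} -> {morph g : x y / x - y} ->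
  (forall k, f << k >> = g << k >>) -> f =1 g.
Proof.
move=> fB gB fg v; rewrite [v]malg_intE !morphB_sum //.
by apply: eq_bigr => k _; rewrite !morphB_Mz // fg.
Qed.

Lemma subgroup_mulz (V : zmodType) (S : V -> Prop) x z :
  S 0 -> (forall x y, S x -> S y -> S (x - y)) -> S x -> S (x *~ z).
Proof.
move=> S0 SB Sx; have SN y : S y -> S (- y).
  by move=> Sy; rewrite -[- y]add0r; apply: SB.
have SMn n : S (x *+ n).
  elim: n => [|n IH]; first by rewrite mulr0n.
  by rewrite mulrSr -[X in _ + X]opprK; apply/SB/SN.
by case: z => n; [exact: SMn | rewrite NegzE mulrNz; apply/SN/SMn].
Qed.

Lemma subgroup_sumz (V : zmodType) (S : V -> Prop) (I : Type) (r : seq I)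
    (F : I -> V) (z : I -> int) :
  S 0 -> (forall x y, S x -> S y -> S (x - y)) -> (forall i, S (F i)) ->
  S (\sum_(i <- r) F i *~ z i).
Proof.
move=> S0 SB SF; elim/big_ind: _ => // [x y Sx Sy|i _].
  by rewrite -[y]opprK; apply: (SB) => //; rewrite -[- y]add0r; apply: SB.
exact: subgroup_mulz.
Qed.

Section MonoidRing.
Variable M : monoidType.

Definition mgen (k : M) : monoid_ring M := << k >>.

Lemma mgenM k l : mgen (k * l)%g = mgen k * mgen l.
Proof. by rewrite -[RHS]/(mring_mul _ _) mring_mulUU mulr1. Qed.

Lemma mgen1 : mgen 1%g = 1. Proof. by []. Qed.

Lemma monoid_ringE (a : monoid_ring M) :
  a = \sum_(k <- msupp a) mgen k *~ a@_k.
Proof. exact: malg_intE. Qed.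

Lemma scale_mgenE (A : lmodType (monoid_ring M)) (a : monoid_ring M) (v : A) :
  a *: v = \sum_(k <- msupp a) (mgen k *: v) *~ a@_k.
Proof.
rewrite {1}[a]monoid_ringE scaler_suml; apply: eq_bigr => k _.
by rewrite scalerMzl.
Qed.

(** The monoid spans its ring over the integers, so linearity amounts to
    additivity and equivariance. *)
Lemma equivariant_linear (A B : lmodType (monoid_ring M)) (f : A -> B) :
  {morph f : x y / x - y} -> (forall k v, f (mgen k *: v) = mgen k *: f v) ->
  linear f.
Proof.
move=> fB fZ a x y; rewrite (morphB_D fB); congr (_ + _).
rewrite [in LHS]scale_mgenE [in RHS]scale_mgenE morphB_sum //.
by apply: eq_bigr => k _; rewrite morphB_Mz // fZ.
Qed.

Lemma mgen_closed (A : lmodType (monoid_ring M)) (S : A -> Prop) :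
  S 0 -> (forall x y, S x -> S y -> S (x - y)) ->
  (forall k x, S x -> S (mgen k *: x)) -> is_submodule S.
Proof.
move=> S0 SB SZ; split=> // a x y Sx Sy.
rewrite -[y]opprK; apply: (SB); last by rewrite -[- y]add0r; apply: SB.
by rewrite scale_mgenE; apply: subgroup_sumz => // k; apply: SZ.
Qed.

Section ModuleOfAction.
Variables (V : zmodType) (act : M -> V -> V).
Hypothesis act1 : forall v, act 1%g v = v.
Hypothesis actM : forall k l v, act (k * l)%g v = act k (act l v).
Hypothesis actB : forall k, {morph act k : v w / v - w}.

Definition act_scale (a : monoid_ring M) v : V := ext_int (act^~ v) a.

Lemma act_scaleU k v : act_scale (mgen k) v = act k v.
Proof. exact: ext_intU. Qed.

Lemma act_scaleBr a : {morph act_scale a : v w / v - w}.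
Proof.
move=> v w; rewrite /act_scale /ext_int -sumrB; apply: eq_bigr => k _.
by rewrite actB mulrzBl.
Qed.

Lemma act_scaleBl v : {morph act_scale^~ v : a b / a - b}.
Proof. exact: ext_intB. Qed.

Lemma act_scaleA a b v : act_scale a (act_scale b v) = act_scale (a * b) v.
Proof.
apply: (ext_int_uniq (f := fun a => act_scale a (act_scale b v))
  (g := fun a : monoid_ring M => act_scale (a * b) v)) => [||k].
- exact: act_scaleBl.
- move=> x y /=; rewrite -act_scaleBl.
  by rewrite -[x - y]/((x : monoid_ring M) - y) mulrBl.
rewrite -/(mgen k).
apply: (ext_int_uniq (f := fun b => act_scale (mgen k) (act_scale b v))
  (g := fun b : monoid_ring M => act_scale (mgen k * b) v)) => [||l].
- by move=> x y /=; rewrite act_scaleBl act_scaleBr.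
- move=> x y /=; rewrite -act_scaleBl.
  by rewrite -[x - y]/((x : monoid_ring M) - y) mulrBr.
by rewrite -/(mgen l) -mgenM !act_scaleU actM.
Qed.

Lemma act_scale1 : left_id 1 act_scale.
Proof. by move=> v; rewrite -mgen1 act_scaleU act1. Qed.

Lemma act_scaleDr : right_distributive act_scale +%R.
Proof. by move=> a; apply/morphB_D/act_scaleBr. Qed.

Lemma act_scaleDl v : {morph act_scale^~ v : a b / a + b}.
Proof. exact/morphB_D/act_scaleBl. Qed.

End ModuleOfAction.
End MonoidRing.

(** The free module on [X], in the form of the free abelian group on [M * X]:
    a valuation, or the restriction to a submonoid of [M], can then be
    described on the basis over the integers. *)
Definition freemod (M : monoidType) (X : choiceType) :=
  {malg int[(M * X)%type]}.

HB.instance Definition _ M X :=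
  GRing.Zmodule.copy (freemod M X) {malg int[(M * X)%type]}.

Section FreeModule.
Variables (M : monoidType) (X : choiceType).

Definition fbas (m : M) (x : X) : freemod M X := << (m, x) >>.

Definition free_act (k : M) : freemod M X -> freemod M X :=
  ext_int (fun u => fbas (k * u.1)%g u.2).

Lemma free_actU k m x : free_act k (fbas m x) = fbas (k * m)%g x.
Proof. exact: ext_intU. Qed.

Lemma free_actB k : {morph free_act k : v w / v - w}.
Proof. exact: ext_intB. Qed.

Lemma free_act1 v : free_act 1%g v = v.
Proof.
apply: (ext_int_uniq (g := id)) => [||[m x]] //; first exact: free_actB.
by rewrite -/(fbas m x) free_actU mul1g.
Qed.

Lemma free_actM k l v : free_act (k * l)%g v = free_act k (free_act l v).
Proof.
apply: (ext_int_uniq (g := free_act k \o free_act l)) => [||[m x]].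
- exact: free_actB.
- by move=> v1 v2 /=; rewrite !free_actB.
by rewrite /= -/(fbas m x) !free_actU mulgA.
Qed.

HB.instance Definition _ :=
  GRing.Zmodule_isLmodule.Build (monoid_ring M) (freemod M X)
    (act_scaleA free_actM free_actB) (act_scale1 free_act1)
    (act_scaleDr free_actB) (act_scaleDl free_act).

Lemma fbasZ k m x : mgen k *: fbas m x = fbas (k * m)%g x.
Proof. by rewrite -[LHS]/(act_scale free_act _ _) act_scaleU free_actU. Qed.

Lemma freemod_eq (V : zmodType) (f g : freemod M X -> V) :
  {morph f : x y / x - y} -> {morph g : x y / x - y} ->
  (forall m x, f (fbas m x) = g (fbas m x)) -> f =1 g.
Proof. by move=> fB gB fg; apply: ext_int_uniq => // -[m x]; apply: fg. Qed.

Lemma freemod_ind (S : freemod M X -> Prop) :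
  S 0 -> (forall v w, S v -> S w -> S (v - w)) ->
  (forall m x, S (fbas m x)) -> forall v, S v.
Proof.
move=> S0 SB SU v; rewrite [v]malg_intE.
by apply: subgroup_sumz => // -[m x]; apply: SU.
Qed.

Section Extension.
Variables (A : lmodType (monoid_ring M)) (f : X -> A).

Definition ext_fun : freemod M X -> A :=
  ext_int (fun u => mgen u.1 *: f u.2).

Lemma ext_funU m x : ext_fun (fbas m x) = mgen m *: f x.
Proof. exact: ext_intU. Qed.

Lemma ext_funB : {morph ext_fun : v w / v - w}.
Proof. exact: ext_intB. Qed.

Lemma ext_fun_linear : linear ext_fun.
Proof.
apply: equivariant_linear => [|k v]; first exact: ext_funB.
apply: (freemod_eq (f := ext_fun \o *:%R (mgen k))
  (g := *:%R (mgen k) \o ext_fun)) => [v1 v2|v1 v2|m x] /=.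
- by rewrite scalerBr ext_funB.
- by rewrite ext_funB scalerBr.
by rewrite fbasZ !ext_funU mgenM scalerA.
Qed.

Definition ext_free : {linear freemod M X -> A} := to_linear ext_fun_linear.

Lemma ext_freeU m x : ext_free (fbas m x) = mgen m *: f x.
Proof. exact: ext_funU. Qed.

Lemma ext_free1 x : ext_free (fbas 1%g x) = f x.
Proof. by rewrite ext_freeU mgen1 scale1r. Qed.

End Extension.

Lemma fbas1Z m x : fbas m x = mgen m *: fbas 1%g x.
Proof. by rewrite fbasZ mulg1. Qed.

Lemma linear_free_eq (A : lmodType (monoid_ring M))
    (f g : {linear freemod M X -> A}) :
  (forall x, f (fbas 1%g x) = g (fbas 1%g x)) -> f =1 g.
Proof.
move=> fg; apply: freemod_eq => [||m x]; [exact: linearB|exact: linearB|].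
by rewrite fbas1Z !linearZ /= fg.
Qed.

(** A lift is determined by a choice of preimages of the basis. *)
Lemma freemod_projective :
  projective (freemod M X : lmodType (monoid_ring M)).
Proof.
move=> B C g f gP; have [b bP] := choice gP.
exists (ext_free (fun x => b (f (fbas 1%g x)))) => v.
have [h hE] := linear_comp (ext_free (fun x => b (f (fbas 1%g x)))) g.
rewrite -hE; apply: linear_free_eq => x.
by rewrite hE ext_free1 bP.
Qed.

End FreeModule.

Definition finite_basis (X : choiceType) : Prop :=
  exists s : seq X, forall x, x \in s.

Lemma freemod_fin_generated (M : monoidType) (X : choiceType) :
  finite_basis X -> fin_generated (freemod M X : lmodType (monoid_ring M)).
Proof.
move=> [s sP]; apply/fin_generatedP; exists (map (fbas 1%g) s) => v.
apply: freemod_ind v => [|v w sv sw|m x]; first exact: Span0.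
  by rewrite -scaleN1r; apply/in_spanD/in_spanZ.
by rewrite fbas1Z; apply/in_spanZ/in_span_mem/map_f/sP.
Qed.

(** * Augmented complexes and the comparison theorem *)

Section Complexes.
Variable R : pzRingType.

Record complex (A : lmodType R) := Complex {
  cx_obj :> nat -> lmodType R;
  cx_d : forall i, {linear cx_obj i.+1 -> cx_obj i};
  cx_aug : {linear cx_obj 0 -> A};
  cx_aug_d : forall x, cx_aug (cx_d 0 x) = 0;
  cx_dd : forall i x, cx_d i (cx_d i.+1 x) = 0 }.

Variable A : lmodType R.
Implicit Types P Q : complex A.

(** In degree [0] the cycles are those of the augmented complex, so that
    exactness at every spot has the same form. *)
Definition is_cycle Q i : Q i -> Prop :=
  match i with
  | 0 => fun x => cx_aug Q x = 0
  | i'.+1 => fun x => cx_d Q i' x = 0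
  end.

Definition is_exact Q : Prop :=
  (forall a, exists x, cx_aug Q x = a) /\
  (forall i (x : Q i), is_cycle x -> exists y, cx_d Q i y = x).

Definition chain_map P Q m (f : forall i, {linear P i -> Q i}) : Prop :=
  (forall x, cx_aug Q (f 0%N x) = cx_aug P x) /\
  (forall i, (i < m)%N -> forall x, cx_d Q i (f i.+1 x) = f i (cx_d P i x)).

Lemma chain_map_cycle P Q m (f : forall i, {linear P i -> Q i}) i (x : P i) :
  chain_map m f -> (i <= m)%N -> is_cycle x -> is_cycle (f i x).
Proof.
by move=> [f0 fS]; case: i x => [|i] x /= le_im cx; rewrite ?f0 // fS // cx linear0.
Qed.

Lemma exact_lift Q i (P : lmodType R) (f : {linear P -> Q i}) :
  is_exact Q -> projective P -> (forall x, is_cycle (f x)) ->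
  exists g : {linear P -> Q i.+1}, forall x, cx_d Q i (g x) = f x.
Proof.
move=> [_ Q_exact] P_proj f_cycle.
by apply: projective_lift => // x; apply: Q_exact.
Qed.

(** The two constructions by induction on the degree that follow choose a map in
    degree [i + 1] subject to a relation to the one in degree [i]; the zero map
    is a default where no such map exists.  The shift [s] is the identity for
    chain maps and the successor for homotopies. *)
Lemma dependent_choice_linear P Q (s : nat -> nat)
    (rel : forall i, {linear P i -> Q (s i)} ->
                     {linear P i.+1 -> Q (s i.+1)} -> Prop)
    (f0 : {linear P 0%N -> Q (s 0%N)}) :
  exists f : forall i, {linear P i -> Q (s i)}, f 0%N = f0 /\
    forall i, (exists g, rel i (f i) g) -> rel i (f i) (f i.+1).
Proof.
have nxt_ex (u : {i & {linear P i -> Q (s i)}}) :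
    exists g : {linear P (projT1 u).+1 -> Q (s (projT1 u).+1)},
    (exists g', rel _ (projT2 u) g') -> rel _ (projT2 u) g.
  move: u => [i f] /=; have [[g fg]|nofg] := pselect (exists g, rel i f g).
    by exists g.
  by exists \0.
pose nxt u := projT1 (cid (nxt_ex u)).
pose f := fix f i : {linear P i -> Q (s i)} :=
  if i is i'.+1 then nxt (existT _ i' (f i')) else f0.
by exists f; split=> // i; apply: (projT2 (cid (nxt_ex (existT _ i (f i))))).
Qed.

(** Existence half of the comparison theorem, truncated at a degree [m] so that
    projectivity is required up to [m] only. *)
Lemma chain_map_exists P Q m :
  (forall i, (i <= m)%N -> projective (P i)) -> is_exact Q ->
  exists f : forall i, {linear P i -> Q i}, chain_map m f.
Proof.
move=> P_proj Q_exact; have [Q_surj _] := Q_exact.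
have [f0 f0E] : exists f0 : {linear P 0%N -> Q 0%N},
    forall x, cx_aug Q (f0 x) = cx_aug P x.
  by apply: projective_lift => //; apply: P_proj.
have [f [ff0 fS]] := dependent_choice_linear (s := id)
  (fun i (f : {linear P i -> Q i}) (g : {linear P i.+1 -> Q i.+1}) =>
     forall x, cx_d Q i (g x) = f (cx_d P i x)) f0.
exists f; split=> [x|]; first by rewrite ff0.
elim=> [|i IH] lt_im; apply: fS.
  have [h hE] := linear_comp (cx_d P 0) (f 0%N).
  have [x|g gE] := exact_lift (f := h) Q_exact (P_proj _ lt_im).
    by rewrite /= hE ff0 f0E cx_aug_d.
  by exists g => x; rewrite gE hE.
have [h hE] := linear_comp (cx_d P i.+1) (f i.+1).
have [x|g gE] := exact_lift (f := h) Q_exact (P_proj _ lt_im).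
  by rewrite /= hE (IH (ltnW lt_im)) cx_dd linear0.
by exists g => x; rewrite gE hE.
Qed.

(** Uniqueness half of the comparison theorem: a chain map lifting zero is
    null-homotopic. *)
Lemma homotopy_exists P Q m (u : forall i, {linear P i -> Q i}) :
  (forall i, (i <= m)%N -> projective (P i)) -> is_exact Q ->
  (forall x, cx_aug Q (u 0%N x) = 0) ->
  (forall i, (i < m)%N -> forall x, cx_d Q i (u i.+1 x) = u i (cx_d P i x)) ->
  exists h : forall i, {linear P i -> Q i.+1},
    (forall x, cx_d Q 0 (h 0%N x) = u 0%N x) /\
    (forall i, (i < m)%N -> forall x,
       cx_d Q i.+1 (h i.+1 x) = u i.+1 x - h i (cx_d P i x)).
Proof.
move=> P_proj Q_exact u0 uS.
have [h0 h0E] := exact_lift (i := 0%N) (f := u 0%N) Q_exact (P_proj _ (leq0n m)) u0.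
have [h [hh0 hS]] := dependent_choice_linear (s := S)
  (fun i (f : {linear P i -> Q i.+1}) (g : {linear P i.+1 -> Q i.+2}) =>
     forall x, cx_d Q i.+1 (g x) = u i.+1 x - f (cx_d P i x)) h0.
have h0' x : cx_d Q 0 (h 0%N x) = u 0%N x by rewrite hh0.
exists h; split=> //.
have step i : (i < m)%N ->
    (forall x, cx_d Q i (h i (cx_d P i x)) = u i (cx_d P i x)) ->
    forall x, cx_d Q i.+1 (h i.+1 x) = u i.+1 x - h i (cx_d P i x).
  move=> lt_im dh; apply: hS.
  have [k kE] := linear_comp (cx_d P i) (h i).
  have [v vE] := linear_sub (u i.+1) k.
  have [x|g gE] := exact_lift (f := v) Q_exact (P_proj _ lt_im).
    by rewrite /= vE kE linearB uS // dh subrr.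
  by exists g => x; rewrite gE vE kE.
elim=> [|i IH] lt_im; apply: step => // x.
by rewrite (IH (ltnW lt_im)) cx_dd linear0 subr0.
Qed.

Section OfResolution.
Variable P : proj_resolution A.

Lemma res_aug_diff x : res_aug P (res_diff P 0 x) = 0.
Proof. by apply/res_exact0; exists x. Qed.

Lemma res_diff_diff i x : res_diff P i (res_diff P i.+1 x) = 0.
Proof. by apply/res_exactS; exists x. Qed.

Definition complex_of : complex A := Complex res_aug_diff res_diff_diff.

Lemma complex_of_exact : is_exact complex_of.
Proof.
split; first exact: res_aug_surj.
by case=> [|i] x /=; [move/res_exact0|move/res_exactS].
Qed.

End OfResolution.

End Complexes.

(** * The canonical free resolution and a finiteness criterion *)

Section CanonicalResolution.
Variable M : monoidType.
Local Notation ring := (monoid_ring M).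
Implicit Types A : lmodType ring.

Lemma fin_generators A : fin_generated A ->
  exists k (e : 'I_k -> A),
    forall a, exists v, ext_free (M := M) (X := 'I_k) e v = a.
Proof.
move=> [k [e eP]]; exists k, e => a; have [c ->] := eP a.
exists (\sum_(i < k) c i *: fbas 1%g i); rewrite linear_sum.
by apply: eq_bigr => i _; rewrite linearZ /= ext_funU mgen1 scale1r.
Qed.

(** A basis for a free cover of [A]: finite whenever that is possible, and all of
    [A] otherwise.  With it the canonical resolution is defined by plain
    recursion and is finitely generated as far as any resolution is. *)
Definition gens A : choiceType :=
  if pselect (fin_generated A) is left fgA
  then ('I_(projT1 (cid (fin_generators fgA))) : choiceType) else A.

Definition gen_val A : gens A -> A :=
  match pselect (fin_generated A) as b return
    (if b is left fgA
     then ('I_(projT1 (cid (fin_generators fgA))) : choiceType) else A) -> A with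
  | left fgA => projT1 (cid (projT2 (cid (fin_generators fgA))))
  | right _ => id
  end.

Definition cover A : {linear freemod M (gens A) -> A} :=
  ext_free (@gen_val A).

Lemma cover_surj A a : exists v, cover A v = a.
Proof.
rewrite /cover /gen_val /gens; case: pselect => [fgA|_].
  exact: (projT2 (cid (projT2 (cid (fin_generators fgA))))).
by exists (fbas 1%g a); rewrite ext_free1.
Qed.

Lemma gens_finite A : fin_generated A -> finite_basis (gens A).
Proof.
rewrite /gens; case: pselect => // fgA _.
by exists (enum 'I_(projT1 (cid (fin_generators fgA)))) => x; rewrite mem_enum.
Qed.

Fixpoint syzygy A (i : nat) : lmodType ring :=
  if i is i'.+1 then submod (ker_submodule (cover (syzygy A i'))) else A.

Definition syz_basis A i : choiceType := gens (syzygy A i).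

Section Differential.
Variable A : lmodType ring.

Definition free_diff i :
  {linear freemod M (syz_basis A i.+1) -> freemod M (syz_basis A i)} :=
  GRing.Linear.clone _ _ _ _
    (submod_val (ker_submodule (cover (syzygy A i))) \o cover (syzygy A i.+1)) _.

Lemma free_aug_diff x : cover A (free_diff 0 x) = 0.
Proof. exact: (submodP (S_sub := ker_submodule (cover A))). Qed.

Lemma free_diff_diff i x : free_diff i (free_diff i.+1 x) = 0.
Proof.
have E : cover (syzygy A i.+1) (free_diff i.+1 x) = 0.
  exact: (submodP (S_sub := ker_submodule (cover (syzygy A i.+1)))).
exact: etrans (congr1 (submod_val (ker_submodule (cover (syzygy A i)))) E)
  (linear0 _).
Qed.

Definition free_res : complex A :=
  @Complex _ A (fun i => freemod M (syz_basis A i)) free_diff (cover A)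
    free_aug_diff free_diff_diff.

Lemma free_res_kernel i (x : free_res i) :
  is_cycle x -> exists y : syzygy A i.+1,
    submod_val (ker_submodule (cover (syzygy A i))) y = x.
Proof.
case: i x => [|i] x /= cx; apply: submod_onto => //.
exact: (submod_val_inj (S_sub := ker_submodule (cover (syzygy A i)))) (etrans cx _).
Qed.

Lemma free_res_exact : is_exact free_res.
Proof.
split=> [|i x /free_res_kernel[y <-]]; first exact: cover_surj.
by have [z zE] := cover_surj y; exists z; rewrite /= -zE.
Qed.

Lemma free_res_projective i : projective (free_res i).
Proof. exact: freemod_projective. Qed.

(** This is why the canonical resolution tests the type FP_n: its degree [i] is
    finitely generated as soon as the [i]-th syzygy is. *)
Lemma syz_basis_finite i :
  fin_generated (syzygy A i) -> finite_basis (syz_basis A i).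
Proof. exact: gens_finite. Qed.

Lemma type_FP_of_syzygies n :
  (forall i, (i <= n)%N -> fin_generated (syzygy A i)) -> type_FP n A.
Proof.
move=> fg; have [surj ex] := free_res_exact.
have ex0 y : cx_aug free_res y = 0 <-> exists z, cx_d free_res 0 z = y.
  by split=> [|[z <-]]; [apply: (ex 0%N)|apply: cx_aug_d].
have exS i y :
    cx_d free_res i y = 0 <-> exists z, cx_d free_res i.+1 z = y.
  by split=> [|[z <-]]; [apply: (ex i.+1)|apply: cx_dd].
exists (ProjResolution free_res_projective surj ex0 exS) => i le_in /=.
exact/freemod_fin_generated/syz_basis_finite/fg.
Qed.

End Differential.

Lemma syzygy_cycle A i (y : syzygy A i.+1) :
  is_cycle (Q := free_res A) (i := i)
    (submod_val (ker_submodule (cover (syzygy A i))) y).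
Proof.
have := submodP y; case: i y => [|i] y E //=.
exact: etrans (congr1 (submod_val (ker_submodule (cover (syzygy A i)))) E)
  (linear0 _).
Qed.

Section FinitenessCriterion.
Variables (A : lmodType ring) (n : nat) (F : complex A).
Variables (C : nat -> nat -> lmodType ring).
Variable j : forall c i, {linear C c i -> F i}.
Hypothesis F_exact : is_exact F.
Hypothesis j_inj : forall c i, injective (j c i).
Hypothesis C_proj : forall c i, (i <= n)%N -> projective (C c i).
Hypothesis C_fg : forall c i, (i <= n)%N -> fin_generated (C c i).
Hypothesis C_diff : forall c i x, exists y, j c i y = cx_d F i (j c i.+1 x).
Hypothesis C_mono : forall c c' i x, (c <= c')%N -> exists y, j c' i y = j c i x.
Hypothesis C_union : forall i (x : F i), (i <= n)%N -> exists c y, j c i y = x.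
Hypothesis C_bound : forall i c, (i < n)%N -> exists2 c', (c <= c')%N &
  forall z, is_cycle (j c i z) -> exists w, cx_d F i (j c' i.+1 w) = j c i z.

Lemma filtered_diff_ex c i :
  exists d : {linear C c i.+1 -> C c i},
    forall x, j c i (d x) = cx_d F i (j c i.+1 x).
Proof.
have [dj djE] := linear_comp (j c i.+1) (cx_d F i).
have [x|d dE] := factor_injective (f := dj) (@j_inj c i).
  by have [y yE] := C_diff x; exists y; rewrite yE djE.
by exists d => x; rewrite dE djE.
Qed.

Lemma filtered_complex c : exists K : forall i, {linear C c i.+1 -> C c i},
  forall i x, j c i (K i x) = cx_d F i (j c i.+1 x).
Proof.
exists (fun i => projT1 (cid (filtered_diff_ex c i))) => i x.
exact: (projT2 (cid (filtered_diff_ex c i))).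
Qed.

Lemma fg_image_filtered (P : lmodType ring) i (f : {linear P -> F i}) :
  fin_generated P -> (i <= n)%N ->
  exists c, forall c', (c <= c')%N -> forall x, exists y, j c' i y = f x.
Proof.
move=> /fin_generatedP[s sP] le_in.
suff [c cP] : exists c, forall c', (c <= c')%N ->
    forall x, x \in s -> exists y, j c' i y = f x.
  exists c => c' le_cc' x; elim: (sP x) => [|a u v us _ [y yE]].
    by exists 0; rewrite !linear0.
  have [z zE] := cP _ le_cc' _ us.
  by exists (a *: z + y); rewrite (linearP (j c' i)) (linearP f) zE yE.
elim: s {sP} => [|u s [c cP]]; first by exists 0%N.
have [c1 [y yE]] := C_union (f u) le_in.
exists (maxn c c1) => c'; rewrite geq_max => /andP[le_c le_c1] x.
rewrite inE => /orP[/eqP ->|xs]; last exact: cP.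
by have [z zE] := C_mono y le_c1; exists z; rewrite zE.
Qed.

Lemma syzygies_image_filtered k (f : forall i, {linear free_res A i -> F i}) :
  (k <= n)%N -> (forall i, (i <= k)%N -> fin_generated (syzygy A i)) ->
  exists c, forall c', (c <= c')%N ->
    forall i, (i <= k)%N -> forall x, exists y, j c' i y = f i x.
Proof.
move=> le_kn fg.
have fgQ i : (i <= k)%N -> fin_generated (free_res A i).
  by move=> le_ik; apply/freemod_fin_generated/syz_basis_finite/fg.
suff : forall l, (l <= k)%N -> exists c, forall c', (c <= c')%N ->
    forall i, (i <= l)%N -> forall x, exists y, j c' i y = f i x.
  by apply.
elim=> [|l IH] le_lk.
  have [c cP] := fg_image_filtered (f 0%N) (fgQ _ le_lk) (leq0n n).
  by exists c => c' le_cc' [|//] _; apply: cP.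
have [c cP] := IH (ltnW le_lk).
have [c1 c1P] := fg_image_filtered (f l.+1) (fgQ _ le_lk) (leq_trans le_lk le_kn).
exists (maxn c c1) => c'; rewrite geq_max => /andP[le_c le_c1] i.
rewrite leq_eqVlt => /orP[/eqP ->|]; first exact: c1P.
by rewrite ltnS; apply: cP.
Qed.

(** Compare the free resolution [Q] with the filtered complex [F] by
    [al : Q -> F].  Up to degree [k] the image of [al] lies in some stage
    [C c'] of the filtration, which maps back to [Q] by [g] since [Q] is exact;
    let [f] be [al] seen as a map into [C c'].  Then [1 - g f] is homotopic to
    zero by some [h], and for a cycle [x] of [Q] in degree [k] this reads
    [x = g (f x) + d (h x)].  By the bounding hypothesis [f x = d w] for some
    [w] in [C c'], so that [x = d (g w) + d (h x)].  Hence the cycles are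
    generated by the images of two finitely generated modules, the stage
    [C c' (k + 1)] and [Q k]. *)
Lemma next_syzygy_fin_generated k :
  (k < n)%N -> (forall i, (i <= k)%N -> fin_generated (syzygy A i)) ->
  fin_generated (syzygy A k.+1).
Proof.
move=> lt_kn fg.
have [al [al0 alS]] := chain_map_exists (m := k)
  (fun i _ => @free_res_projective A i) F_exact.
have [c cP] := syzygies_image_filtered al (ltnW lt_kn) fg.
have [c' le_cc' c'P] := C_bound c lt_kn.
have [dC dCE] := filtered_complex c'.
have [eC eCE] := linear_comp (j c' 0) (cx_aug F).
have eCd x : eC (dC 0%N x) = 0 by rewrite eCE dCE cx_aug_d.
have dCd i x : dC i (dC i.+1 x) = 0.
  by apply: j_inj; rewrite !dCE cx_dd linear0.
pose K := Complex eCd dCd.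
have f_ex i : exists f : {linear free_res A i -> K i},
    (i <= k)%N -> forall x, j c' i (f x) = al i x.
  have [le_ik|_] := leqP i k; last by exists \0.
  have [f fE] := factor_injective (f := al i) (@j_inj c' i)
    (cP _ le_cc' _ le_ik).
  by exists f.
pose f i := projT1 (cid (f_ex i)).
have fE i x : (i <= k)%N -> j c' i (f i x) = al i x.
  by move=> le_ik; apply: (projT2 (cid (f_ex i))).
have [g [g0 gS]] := chain_map_exists (P := K) (m := k.+1)
  (fun i le_i => @C_proj c' i (leq_trans le_i lt_kn)) (free_res_exact A).
have u_ex i : exists u : {linear free_res A i -> free_res A i},
    forall x, u x = x - g i (f i x).
  have [gf gfE] := linear_comp (f i) (g i).
  have [idQ idQE] := linear_id (free_res A i).
  have [u uE] := linear_sub idQ gf.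
  by exists u => x; rewrite uE gfE idQE.
pose u i := projT1 (cid (u_ex i)).
have uE i x : u i x = x - g i (f i x) by apply: (projT2 (cid (u_ex i))).
have [||h [h0 hS]] := homotopy_exists (m := k) (u := u)
    (fun i _ => @free_res_projective A i) (free_res_exact A).
- by move=> x; rewrite uE linearB g0 /= eCE fE // al0 subrr.
- move=> i lt_ik x; rewrite !uE linearB gS ?(ltnW lt_ik) //; last exact: ltnW.
  congr (_ - g i _); apply: j_inj.
  by rewrite /= dCE !fE ?(ltnW lt_ik) // alS.
have hk x : is_cycle x -> cx_d (free_res A) k (h k x) = x - g k (f k x).
  case: (k) (hS) x => [|l] hl x; first by rewrite h0 uE.
  by move=> dx; rewrite hl // dx linear0 subr0 uE.
have [p pE] := linear_comp (g k.+1) (cover (syzygy A k.+1)).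
have [q qE] := linear_comp (h k) (cover (syzygy A k.+1)).
apply: (fin_generated_cover (u := p) (v := q)).
- exact: C_fg.
- exact/freemod_fin_generated/syz_basis_finite/fg.
move=> y; set x := submod_val (ker_submodule (cover (syzygy A k))) y.
have x_cyc : is_cycle (Q := free_res A) x by exact: syzygy_cycle.
have al_cyc : is_cycle (al k x) by apply: (chain_map_cycle (m := k)) x_cyc.
have [z zE] := cP c (leqnn c) k (leqnn k) x.
have [w wE] := c'P z ltac:(by rewrite zE).
have dw : dC k w = f k x by apply: j_inj; rewrite dCE wE zE fE.
have xE : x = cx_d (free_res A) k (g k.+1 w) + cx_d (free_res A) k (h k x).
  by rewrite hk // gS //= dw addrC subrK.
exists w, x; apply: submod_val_inj.
by rewrite linearD pE qE; apply: xE.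
Qed.

(** One half of Brown's criterion, in the following form: a resolution of [A] that
    is the union of an increasing sequence of complexes of projectives, finitely
    generated up to degree [n], shows that [A] is of type FP_n if each cycle of
    degree less than [n] in a given stage bounds in a later stage that depends
    on the given stage only. *)
Theorem syzygies_fin_generated :
  fin_generated A -> forall i, (i <= n)%N -> fin_generated (syzygy A i).
Proof.
move=> fgA; suff : forall k, (k <= n)%N -> forall i, (i <= k)%N ->
    fin_generated (syzygy A i) by apply.
elim=> [|k IH] lt_kn i; first by case: i.
rewrite leq_eqVlt => /orP[/eqP ->|]; last by rewrite ltnS; apply/IH/ltnW.
exact/next_syzygy_fin_generated/IH/ltnW.
Qed.

End FinitenessCriterion.

(** Brown's criterion for the constant filtration of a given resolution. *)
Lemma type_FP_syzygies A n :
  type_FP n A -> forall i, (i <= n)%N -> fin_generated (syzygy A i).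
Proof.
move=> [P P_fg].
have idP i : exists u : {linear P i -> P i}, forall x, u x = x.
  exact: linear_id.
pose idj i := projT1 (cid (idP i)).
have idE i x : idj i x = x by apply: (projT2 (cid (idP i))).
have [surj _] := complex_of_exact P.
apply: (@syzygies_fin_generated A n (complex_of P) (fun _ i => P i)
  (fun _ i => idj i)).
- exact: complex_of_exact.
- by move=> _ i x y; rewrite !idE.
- by move=> _ i _; apply: res_proj.
- by move=> _ i; apply: P_fg.
- by move=> _ i x; eexists; rewrite idE.
- by move=> _ _ i x _; eexists; rewrite idE.
- by move=> i x _; exists 0%N, x; rewrite idE.
- move=> i c _; exists c => // z; rewrite idE => cz.
  by have [w wE] := (complex_of_exact P).2 i z cz; exists w; rewrite idE.
exact: (fin_generated_surj (u := res_aug P) (P_fg 0%N (leq0n n))).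
Qed.

End CanonicalResolution.

(** * Change of monoid *)

Section Supports.
Variables (K : choiceType).
Implicit Types (P : K -> Prop) (v w : {malg int[K]}).

Definition supported P v : Prop := forall u, u \in msupp v -> P u.

Lemma supported0 P : supported P 0.
Proof. by move=> u; rewrite msupp0 inE. Qed.

Lemma supportedB P v w : supported P v -> supported P w -> supported P (v - w).
Proof.
move=> Pv Pw u /(fsubsetP (msuppB_le v w)); rewrite inE => /orP[]; [exact: Pv|exact: Pw].
Qed.

Lemma supportedU P u : P u -> supported P << u >>.
Proof. by move=> Pu u' /(fsubsetP msuppU_le); rewrite inE => /eqP ->. Qed.

Lemma supported_sub P P' v :
  (forall u, P u -> P' u) -> supported P v -> supported P' v.
Proof. by move=> PP' Pv u /Pv; apply: PP'. Qed.

(** The support of [v] may be smaller than the set of all [u] with [P u], but [v]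
    is a combination of the basis elements in its support. *)
Lemma supported_ind P (S : {malg int[K]} -> Prop) :
  S 0 -> (forall v w, S v -> S w -> S (v - w)) ->
  (forall u, P u -> S << u >>) -> forall v, supported P v -> S v.
Proof.
move=> S0 SB SU v Pv; have [[u0 u0v]|no_u] := pselect (exists u, u \in msupp v).
  rewrite [v]malg_intE (eq_big_seq (fun u =>
    (if u \in msupp v then << u >> else << u0 >>) *~ v@_u)).
    by apply: subgroup_sumz => // u; case: ifP => uv; apply/SU/Pv.
  by move=> u ->.
rewrite [v]malg_intE big1_seq // => u /andP[_ uv].
by case: no_u; exists u.
Qed.

End Supports.

Definition monoid_hom (H M : monoidType) (phi : H -> M) : Prop :=
  phi 1%g = 1%g /\ {morph phi : x y / (x * y)%g}.

Lemma trivialZ (M : monoidType) k (z : trivial_module M) : mgen k *: z = z.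
Proof. by rewrite -[LHS]/(augmentation _ * z) augmentationU mul1r. Qed.

Section Restriction.
Variables (H M : monoidType) (phi : H -> M).
Implicit Types A B : lmodType (monoid_ring M).

(** Restriction of scalars along [phi].  The carrier is unchanged; the proof that
    [phi] is a morphism is an argument so that the new action can be found from
    the type. *)
Definition restr of monoid_hom phi := fun A => (A : Type).

Variable phi_hom : monoid_hom phi.

HB.instance Definition _ A := GRing.Zmodule.copy (restr phi_hom A) A.

Section Action.
Variable A : lmodType (monoid_ring M).

Definition restr_act (h : H) (v : restr phi_hom A) : restr phi_hom A :=
  mgen (phi h) *: (v : A).

Lemma restr_act1 v : restr_act 1%g v = v.
Proof. by rewrite /restr_act phi_hom.1 mgen1 scale1r. Qed.

Lemma restr_actM k l v : restr_act (k * l)%g v = restr_act k (restr_act l v).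
Proof. by rewrite /restr_act phi_hom.2 mgenM scalerA. Qed.

Lemma restr_actB k : {morph restr_act k : v w / v - w}.
Proof. by move=> v w; apply: scalerBr. Qed.

HB.instance Definition _ :=
  GRing.Zmodule_isLmodule.Build (monoid_ring H) (restr phi_hom A)
    (act_scaleA restr_actM restr_actB) (act_scale1 restr_act1)
    (act_scaleDr restr_actB) (act_scaleDl restr_act).

Lemma restrZ h (v : restr phi_hom A) :
  mgen h *: v = mgen (phi h) *: (v : A) :> A.
Proof. by rewrite -[LHS]/(act_scale restr_act _ _) act_scaleU. Qed.

End Action.

Lemma to_restrZ (B : lmodType (monoid_ring H)) A
    (f : {linear B -> restr phi_hom A}) h v :
  f (mgen h *: v) = mgen (phi h) *: (f v : A) :> A.
Proof. by rewrite (linearZ_LR f) restrZ. Qed.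

Lemma to_restrB (B : lmodType (monoid_ring H)) A
    (f : {linear B -> restr phi_hom A}) v w :
  f (v - w) = (f v : A) - (f w : A) :> A.
Proof. exact: (linearB f). Qed.

Lemma restr_linear A B (f : {linear A -> B}) :
  linear (f : restr phi_hom A -> restr phi_hom B).
Proof.
apply: equivariant_linear => [|k v]; first exact: (linearB f).
by rewrite restrZ [RHS]restrZ linearZ.
Qed.

(** Every monoid acts trivially on [Z], so the augmentation of a complex remains
    an augmentation after restriction. *)
Lemma restr_aug_linear A (f : {linear A -> trivial_module M}) :
  linear (f : restr phi_hom A -> trivial_module H).
Proof.
apply: equivariant_linear => [|k v]; first exact: (linearB f).
by rewrite restrZ linearZ /= !trivialZ.
Qed.

Definition restr_complex (F : complex (trivial_module M)) :
  complex (trivial_module H) :=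
  @Complex _ (trivial_module H) (fun i => restr phi_hom (F i))
    (fun i => to_linear (restr_linear (cx_d F i)))
    (to_linear (restr_aug_linear (cx_aug F)))
    (@cx_aug_d _ _ F) (@cx_dd _ _ F).

Lemma restr_complex_exact F : is_exact F -> is_exact (restr_complex F).
Proof. by move=> [F_surj F_ex]; split=> // -[|i] x; apply: F_ex. Qed.

End Restriction.

(** For [phi] the conjugation by [t], this turns comparison maps into the twisted
    module into maps with values in the multiples of [t]. *)
Lemma twist_linear (M : monoidType) (phi : M -> M) (phi_hom : monoid_hom phi)
    (A B : lmodType (monoid_ring M)) (f : {linear A -> restr phi_hom B}) (t : M) :
  (forall s, t * phi s = s * t)%g ->
  linear (fun v => mgen t *: (f v : B)).
Proof.
move=> comm; apply: equivariant_linear => [v w|s v].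
  by rewrite to_restrB scalerBr.
by rewrite to_restrZ !scalerA -!mgenM comm.
Qed.

Lemma fsupported_ind (M : monoidType) (X : choiceType) (P : M * X -> Prop)
    (S : freemod M X -> Prop) :
  S 0 -> (forall v w, S v -> S w -> S (v - w)) ->
  (forall m x, P (m, x) -> S (fbas m x)) -> forall v, supported P v -> S v.
Proof. by move=> S0 SB SU; apply: supported_ind => // -[m x]; apply: SU. Qed.

Lemma archimedean_mulrn (R : realType) (x eps : R) :
  0 < eps -> exists k, x <= eps *+ k.
Proof.
move=> eps0; exists (Num.truncn (x / eps)).+1.
by rewrite -[eps *+ _]mulr_natl -ler_pdivrMr //; apply/ltW/truncnS_gt.
Qed.

(** * Lattices over the monoid of a character *)

Section Lattice.
Variables (R : realType) (G : groupType) (chi : real_hom R G).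
Local Notation S := (nonneg_monoid chi).

Lemma real_homV g : chi g^-1%g = - chi g.
Proof. by apply: (addrI (chi g)); rewrite -real_homM mulgV real_hom1 subrr. Qed.

Lemma real_homX g k : chi (g ^+ k)%g = chi g *+ k.
Proof.
elim: k => [|k IH]; first by rewrite expg0 real_hom1 mulr0n.
by rewrite expgS real_homM IH mulrS.
Qed.

Lemma real_homJ g h : chi (g ^ h)%g = chi g.
Proof. by rewrite conjgE !real_homM real_homV addrC addrK. Qed.

Lemma nonneg_val_hom : monoid_hom (val : S -> G).
Proof. by split=> [|x y]; [exact: val1|exact: valM]. Qed.

Lemma nonneg_onto g : 0 <= chi g -> exists s : S, val s = g.
Proof. by move=> g0; exists (exist _ g g0). Qed.

Lemma nonneg_valP (s : S) : 0 <= chi (val s).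
Proof. exact: (valP s). Qed.

Section Inclusion.
Variables (X : choiceType) (b : X -> G).

(** The submodule of [Z[G]^(X)] over the monoid ring of [G_chi] that is generated
    by the translates [b x] of the basis elements.  It is free on them, and
    consists of the elements supported where [chi g >= chi (b x)]
    ([lattice_onto], [lattice_supported]). *)
Definition lattice :
  {linear freemod S X -> restr nonneg_val_hom (freemod G X)} :=
  ext_free (fun x => fbas (b x) x : restr nonneg_val_hom (freemod G X)).

Lemma latticeU s x : lattice (fbas s x) = fbas (val s * b x)%g x.
Proof. by rewrite [LHS]ext_freeU restrZ fbasZ. Qed.

Lemma latticeZ s v : lattice (mgen s *: v) = mgen (val s) *: lattice v.
Proof. by rewrite linearZ /= restrZ. Qed.

Lemma lattice_inj : injective lattice.
Proof.
(* A left inverse on the basis; the value [0] is taken outside the lattice. *)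
pose inv (u : G * X) : freemod S X :=
  if pselect (exists s : S, val s = u.1 * (b u.2)^-1)%g is left e
  then fbas (projT1 (cid e)) u.2 else 0.
suff : cancel lattice (ext_int inv) by apply: can_inj.
apply: (freemod_eq (f := ext_int inv \o lattice) (g := id)) => [v w|//|s x].
  by rewrite /comp linearB ext_intB.
rewrite /comp latticeU ext_intU /inv /=; case: pselect => [e|[]].
  case: (cid e) => s' /= s'E; suff -> : s' = s by [].
  by apply: val_inj; apply: etrans s'E _; apply: mulgK.
by exists s; rewrite mulgK.
Qed.

Lemma lattice_onto v :
  supported (fun u => chi (b u.2) <= chi u.1) v -> exists y, lattice y = v.
Proof.
move: v; apply: fsupported_ind => [|v w [x <-] [y <-]|g x le_g].
- by exists 0; rewrite linear0.
- by exists (x - y); rewrite linearB.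
have [s sE] : exists s : S, val s = (g * (b x)^-1)%g.
  by apply: nonneg_onto; rewrite real_homM real_homV subr_ge0; apply: le_g.
by exists (fbas s x); rewrite latticeU sE mulgVK.
Qed.

Lemma lattice_supported y :
  supported (fun u => chi (b u.2) <= chi u.1) (lattice y).
Proof.
apply: (freemod_ind (S := fun y => supported _ (lattice y))) y => [|v w|s x].
- by rewrite linear0; apply: supported0.
- by rewrite linearB; apply: supportedB.
rewrite latticeU; apply: supportedU => /=.
by rewrite real_homM lerDr nonneg_valP.
Qed.

End Inclusion.
End Lattice.

Lemma supported_shift (M : monoidType) (X : choiceType) (P P' : M * X -> Prop)
    k (v : freemod M X) :
  (forall m x, P (m, x) -> P' (k * m, x)%g) -> supported P v ->
  supported P' (mgen k *: v).
Proof.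
move=> PP'; apply: (fsupported_ind (P := P)
  (S := fun v => supported P' (mgen k *: v))) => [|x y Px Py|m x Pu].
- by rewrite scaler0; apply: supported0.
- by rewrite scalerBr; apply: (supportedB Px Py).
by rewrite fbasZ; apply: supportedU; apply: PP'.
Qed.

(** * A contracting endomorphism *)

Section ContractingEndomorphism.
Variables (R : realType) (H : groupType) (psi : real_hom R H) (n : nat).
Variable t : H.
Hypothesis t_gt0 : 0 < psi t.
Local Notation S := (nonneg_monoid psi).
Local Notation Q := (free_res (trivial_module S)).
Local Notation X := (syz_basis (trivial_module S)).
Local Notation iota := (lattice psi (fun=> 1%g)).

Lemma iota1 (Y : choiceType) (x : Y) : iota (fbas 1%g x) = fbas 1%g x.
Proof. by rewrite latticeU val1 mulg1. Qed.

(** Extension of scalars to the group ring is a localization at the powers of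
    [t]: each element is carried into the lattice by all large powers. *)
Lemma iota_absorbs (Y : choiceType) (v : freemod H Y) :
  exists k, forall k', (k <= k')%N -> exists q, iota q = mgen (t ^+ k')%g *: v.
Proof.
move: v; apply: freemod_ind => [|v w [k1 k1P] [k2 k2P]|m x].
- by exists 0%N => k' _; exists 0; rewrite linear0 scaler0.
- exists (maxn k1 k2) => k'; rewrite geq_max => /andP[/k1P[q1 q1E] /k2P[q2 q2E]].
  by exists (q1 - q2); rewrite linearB q1E q2E scalerBr.
have [k kP] := archimedean_mulrn (- psi m) t_gt0.
exists k => k' le_kk'; rewrite fbasZ; apply: lattice_onto.
apply: supportedU => /=; rewrite real_hom1 real_homM real_homX.
rewrite -lerBlDr sub0r (le_trans kP) //.
by rewrite -(subnK le_kk') mulrnDr lerDr mulrn_wge0 // ltW.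
Qed.

Section Induce.
Variables (Y Z : choiceType) (f : {linear freemod S Y -> freemod S Z}).

(** Extension of scalars of a map between free modules, given on the basis. *)
Definition induced : {linear freemod H Y -> freemod H Z} :=
  ext_free (fun x => iota (f (fbas 1%g x)) : freemod H Z).

Lemma induced_iota v : induced (iota v) = iota (f v).
Proof.
move: v; apply: (freemod_eq (f := induced \o iota) (g := iota \o f)).
- by move=> v w; rewrite /comp (linearB iota) (linearB induced).
- by move=> v w; rewrite /comp (linearB f) (linearB iota).
move=> s x; rewrite /comp latticeU mulg1 ext_freeU.
by rewrite [fbas s x]fbas1Z (linearZ_LR f) latticeZ.
Qed.

End Induce.

Definition induced_aug : {linear freemod H (X 0) -> trivial_module H} :=
  ext_free (fun x => cx_aug Q (fbas 1%g x) : trivial_module H).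

Lemma induced_aug_iota v : induced_aug (iota v) = cx_aug Q v.
Proof.
move: v; apply: (freemod_eq (f := induced_aug \o iota) (g := cx_aug Q)).
- by move=> v w; rewrite /comp (linearB iota) (linearB induced_aug).
- exact: linearB.
move=> s x; rewrite /comp latticeU mulg1 ext_freeU trivialZ.
by rewrite [in RHS]fbas1Z (linearZ_LR (cx_aug Q)) trivialZ.
Qed.

Lemma induced_aug_d v : induced_aug (induced (cx_d Q 0) v) = 0.
Proof.
have [f fE] := linear_comp (induced (cx_d Q 0)) induced_aug.
rewrite -fE -[RHS]/(\0 v); apply: linear_free_eq => x.
by rewrite fE -iota1 induced_iota induced_aug_iota cx_aug_d.
Qed.

Lemma induced_dd i v : induced (cx_d Q i) (induced (cx_d Q i.+1) v) = 0.
Proof.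
have [f fE] := linear_comp (induced (cx_d Q i.+1)) (induced (cx_d Q i)).
rewrite -fE -[RHS]/(\0 v); apply: linear_free_eq => x.
by rewrite fE -iota1 !induced_iota (@cx_dd _ _ Q) linear0.
Qed.

Definition induced_complex : complex (trivial_module H) :=
  @Complex _ (trivial_module H) (fun i => freemod H (X i))
    (fun i => induced (cx_d Q i)) induced_aug induced_aug_d induced_dd.

(** A cycle becomes, after multiplication by a power of [t], a cycle of the
    complex over the monoid; there it bounds, and dividing by that power gives
    back the cycle itself. *)
Lemma induced_exact : is_exact induced_complex.
Proof.
have [Q_surj Q_ex] := free_res_exact (trivial_module S).
split=> [a|i v v_cyc].
  by have [x xE] := Q_surj a; exists (iota x); rewrite [LHS]induced_aug_iota.
have [k /(_ k (leqnn k))[q qE]] := iota_absorbs v.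
have q_cyc : is_cycle (Q := Q) (i := i) q.
  case: i v v_cyc q qE => [|i] v v_cyc q qE.
    rewrite /is_cycle -induced_aug_iota qE (linearZ_LR induced_aug) trivialZ.
    exact: v_cyc.
  have E : iota (cx_d Q i q) = iota 0.
    rewrite -induced_iota qE (linearZ_LR (induced (cx_d Q i))).
    by rewrite [X in _ *: X]v_cyc scaler0 linear0.
  exact (lattice_inj E).
have [z zE] := Q_ex i q q_cyc.
exists (mgen (t ^+ k)^-1%g *: iota z).
rewrite [LHS](linearZ_LR (induced (cx_d Q i))) induced_iota zE qE.
by rewrite scalerA -mgenM mulVg mgen1 scale1r.
Qed.

Lemma conj_nonneg (s : S) : 0 <= psi (val s ^ t)%g.
Proof. by rewrite real_homJ nonneg_valP. Qed.

Definition conj_monoid (s : S) : S := exist _ (val s ^ t)%g (conj_nonneg s).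

Lemma conj_monoid_hom : monoid_hom conj_monoid.
Proof.
split=> [|x y]; apply: val_inj; first exact: conj1g.
by apply: etrans (conjMg _ _ _) _; rewrite valM.
Qed.

Definition pos_elt : S := exist _ t (ltW t_gt0).

(** Multiplication by [t] is linear from the restriction of [P] along the
    conjugation by [t] back to [P].  That restriction is again exact, so the
    identity of [Z] lifts to a map from [P] into it; composing the two gives a
    lift of the identity whose values are multiples of [t]. *)
Lemma twisted_endomorphism (P : complex (trivial_module S)) :
  (forall i, projective (P i)) -> is_exact P ->
  exists f : forall i, {linear P i -> P i},
  chain_map n f /\ forall i v, exists w, f i v = mgen pos_elt *: w.
Proof.
move=> P_proj P_exact.
have [f [f0 fS]] := chain_map_exists (m := n) (fun i _ => P_proj i)
  (restr_complex_exact conj_monoid_hom P_exact).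
have comm s : (pos_elt * conj_monoid s)%g = (s * pos_elt)%g.
  by apply: val_inj; rewrite !valM -conjgC.
exists (fun i => to_linear (twist_linear (f i) comm)).
split=> [|i v]; last by exists (f i v).
split=> [v|i lt_in v]; rewrite !to_linearE.
  by rewrite (linearZ_LR (cx_aug P)) trivialZ; apply: f0.
by rewrite (linearZ_LR (cx_d P i)); congr (_ *: _); apply: fS.
Qed.

(** The values of the twisted endomorphism are supported where
    [psi >= psi t > 0]. *)
Lemma contracting_endomorphism :
  exists phi : forall i, {linear induced_complex i -> induced_complex i},
  chain_map n phi /\ forall i x,
    supported (fun u => 0 < psi u.1) (phi i (fbas 1%g x)).
Proof.
have [f [[f0 fS] f_t]] := twisted_endomorphism
  (@free_res_projective _ (trivial_module S)) (free_res_exact _).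
exists (fun i => induced (f i)); split; last first.
  move=> i x; have [w wE] := f_t i (fbas 1%g x).
  rewrite -iota1 induced_iota wE latticeZ.
  apply: (@supported_shift _ _ (fun u => psi 1%g <= psi u.1) _ _ (iota w)).
    by move=> m y /=; rewrite real_hom1 real_homM => m_ge0; apply: ltr_pwDl.
  exact: lattice_supported.
split=> [v|i lt_in v].
  have [g gE] := linear_comp (induced (f 0%N)) induced_aug.
  rewrite -[LHS]gE; apply: linear_free_eq => x.
  by rewrite gE -iota1 induced_iota [RHS]induced_aug_iota induced_aug_iota f0.
have [g gE] := linear_comp (induced (f i.+1)) (induced (cx_d Q i)).
have [h hE] := linear_comp (induced (cx_d Q i)) (induced (f i)).
rewrite -[LHS]gE -[RHS]hE; apply: linear_free_eq => x.
by rewrite gE hE -iota1 !induced_iota fS.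
Qed.

End ContractingEndomorphism.

(** * Complete modules *)

Section CompleteModules.
Variables (R : realType) (G : groupType) (chi : real_hom R G).
Local Notation ring := (monoid_ring G).

(** The action of a matrix over [Z[G]] on families of elements of [A], the row of
    index [x] being the list [s x] of its terms [(c, g, y)], standing for
    [c * g] in column [y]. *)
Definition combination (A : lmodType ring) (X : choiceType)
    (s : X -> seq (int * G * X)) (m : X -> A) (x : X) : A :=
  \sum_(u <- s x) (mgen u.1.2 *: m u.2) *~ u.1.1.

Definition positive_system (X : choiceType) (s : X -> seq (int * G * X)) :=
  forall x u, u \in s x -> 0 < chi u.1.2.

(** Every [1 - T] with [T] a matrix supported where [chi > 0] is invertible on
    [A ^ X]. *)
Definition complete (A : lmodType ring) : Prop :=
  forall (X : choiceType) (s : X -> seq (int * G * X)),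
    finite_basis X -> positive_system s ->
    (forall m : X -> A, exists m', forall x, m' x - combination s m' x = m x) /\
    (forall m : X -> A, (forall x, m x = combination s m x) ->
       forall x, m x = 0).

Section Solve.
Variables (N : groupClosed G) (X : choiceType).
Local Notation H := (subgroup N).

Lemma subgroup_val_hom : monoid_hom (val : H -> G).
Proof. by split=> [|x y]; [exact: val1|exact: valM]. Qed.

Variable phi : {linear freemod H X -> freemod H X}.
Hypothesis X_fin : finite_basis X.
Hypothesis phi_pos : forall x,
  supported (fun u => 0 < chi (val u.1)) (phi (fbas 1%g x)).
Variable A : lmodType ring.
Hypothesis A_complete : complete A.
Local Notation B := (restr subgroup_val_hom A).

Definition endo_system (x : X) : seq (int * G * X) :=
  [seq ((phi (fbas 1%g x))@_u, val u.1, u.2) | u <- msupp (phi (fbas 1%g x))].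

Lemma endo_system_positive : positive_system endo_system.
Proof. move=> x _ /mapP[u u_phi ->]; have u_pos := phi_pos u_phi; exact u_pos. Qed.

Lemma endo_combination (m : X -> A) x :
  ext_free (m : X -> B) (phi (fbas 1%g x)) = combination endo_system m x.
Proof.
rewrite -[LHS]/(ext_int _ _) /ext_int /combination /endo_system big_map.
by apply: eq_bigr => u _; rewrite restrZ.
Qed.

(** A map [w] from a free module is a family of elements of [A], and [w \o phi] is
    the image of this family under the matrix of [phi]. *)
Lemma solve_exists (u : {linear freemod H X -> B}) :
  exists w : {linear freemod H X -> B}, forall v, w v - w (phi v) = u v.
Proof.
have [sol _] := A_complete X_fin endo_system_positive.
have [m mE] := sol (fun x => u (fbas 1%g x)).
exists (ext_free (m : X -> B)) => v.
have [wphi wphiE] := linear_comp phi (ext_free (m : X -> B)).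
have [l lE] := linear_sub (ext_free (m : X -> B)) wphi.
rewrite -wphiE -lE; apply: linear_free_eq => x.
by rewrite lE wphiE ext_free1 endo_combination mE.
Qed.

Lemma solve_unique (w : {linear freemod H X -> B}) :
  (forall v, w v = w (phi v)) -> forall v, w v = 0.
Proof.
move=> w_phi v; have [_ uniq] := A_complete X_fin endo_system_positive.
have wE : w =1 ext_free (fun x => w (fbas 1%g x)).
  by apply: linear_free_eq => x; rewrite ext_free1.
rewrite -[RHS]/((\0 : {linear freemod H X -> B}) v).
apply: linear_free_eq => x.
apply: (uniq (fun x => w (fbas 1%g x))) => y.
by rewrite -endo_combination -wE w_phi.
Qed.

End Solve.
End CompleteModules.

(** * Free modules over a subgroup *)

Section RestrictedFree.
Variables (G : groupType) (N : groupClosed G) (X : choiceType).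
Local Notation H := (subgroup N).

(** The chosen element depends on the predicate alone, so that all elements of the
    coset [N g] receive the same representative. *)
Definition coset_repr (g : G) : G := choose (fun y => y * g^-1 \in N)%g g.

Lemma coset_reprP g : (coset_repr g * g^-1 \in N)%g.
Proof.
by apply: (chooseP (P := fun y => y * g^-1 \in N)%g); rewrite mulgV gpred1.
Qed.

Lemma coset_repr_coset h g :
  h \in N -> coset_repr (h * g)%g = coset_repr g.
Proof.
move=> hN; rewrite /coset_repr.
have PE : (fun y => y * (h * g)^-1 \in N)%g =1 (fun y => y * g^-1 \in N)%g.
  move=> y; rewrite invgM mulgA; apply/idP/idP => [yN|yN].
    by rewrite -[(y * g^-1)%g](mulgVK h) gpredM.
  by rewrite gpredM // gpredV.
rewrite (eq_choose PE); apply: choose_id.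
  by rewrite mulgK.
by rewrite mulgV gpred1.
Qed.

Definition coset_part (g : G) : G := (g * (coset_repr g)^-1)%g.

Lemma coset_part_in g : coset_part g \in N.
Proof.
have -> : coset_part g = ((coset_repr g * g^-1)^-1)%g by rewrite invgM invgK.
by rewrite gpredV coset_reprP.
Qed.

Lemma coset_partM h g :
  h \in N -> coset_part (h * g)%g = (h * coset_part g)%g.
Proof. by move=> hN; rewrite /coset_part coset_repr_coset // mulgA. Qed.

Lemma coset_partK g : (coset_part g * coset_repr g)%g = g.
Proof. exact: mulgVK. Qed.

(** The chosen representatives of the cosets of [N], paired with [X], form a basis
    of [Z[G]^(X)] over [Z[N]]. *)
Lemma restr_freemod_projective :
  projective (restr (subgroup_val_hom N) (freemod G X)).
Proof.
move=> B C q f q_surj; have [b bP] := choice q_surj.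
pose part g : H := exist _ (coset_part g) (coset_part_in g).
have partM (h : H) g : part (val h * g)%g = (h * part g)%g.
  by apply: val_inj; rewrite valM; apply/coset_partM/(valP h).
pose e (u : G * X) : B :=
  mgen (part u.1) *: b (f (fbas (coset_repr u.1) u.2)).
have e_lin : linear (ext_int e : restr (subgroup_val_hom N) (freemod G X) -> B).
  apply: equivariant_linear => [|h v]; first exact: ext_intB.
  move: v; apply: (freemod_eq (M := G) (X := X)
    (f := fun v => ext_int e (mgen h *: (v : restr (subgroup_val_hom N) (freemod G X))))
    (g := fun v => mgen h *: ext_int e v)) => [v w|v w|g x].
  - by rewrite restrZ scalerBr ext_intB -!restrZ.
  - by rewrite ext_intB scalerBr.
  rewrite restrZ fbasZ !ext_intU /e /= partM mgenM scalerA.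
  by rewrite coset_repr_coset //; apply: (valP h).
exists (to_linear e_lin); apply: (freemod_eq (M := G) (X := X)) => [v w|v w|g x].
- by rewrite !to_linearE ext_intB (linearB q).
- exact: (linearB f).
rewrite to_linearE ext_intU /e /= (linearZ_LR q) bP -(linearZ_LR f) restrZ.
by rewrite fbasZ coset_partK.
Qed.

End RestrictedFree.

(** * Natural contractions *)

Section Contractions.
Variables (R : realType) (G : groupType) (chi : real_hom R G).
Local Notation ring := (monoid_ring G).
Implicit Types (K : groupClosed G) (A : lmodType ring).

(** Cochains are bare functions subject to this predicate, so that operators on
    cochains over different subgroups are operators on the same functions. *)
Definition equivariant K (F A : lmodType ring) (f : F -> A) : Prop :=
  {morph f : x y / x - y} /\
  (forall k, k \in K -> forall v, f (mgen k *: v) = mgen k *: f v).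

Definition natural_operator K (F F' : lmodType ring)
    (s : forall A, (F -> A) -> F' -> A) : Prop :=
  [/\ forall A, complete chi A -> forall f : F -> A,
        equivariant K f -> equivariant K (s A f),
      forall A, complete chi A -> forall f g : F -> A,
        equivariant K f -> equivariant K g -> forall v,
        s A (fun x => f x - g x) v = s A f v - s A g v &
      forall A A' (q : {linear A -> A'}), complete chi A -> complete chi A' ->
        forall f : F -> A, equivariant K f -> forall v,
        s A' (fun x => q (f x)) v = q (s A f v)].

(** A contraction up to degree [n] of the complexes of [K]-equivariant cochains,
    given by additive operators that are natural in the complete module [A].
    Additivity is needed to correct one contraction by another, and naturality
    to apply it to a chain map into a complex of complete modules. *)
Definition contraction K (n : nat) (C : lmodType ring) (F : complex C)
    (s : forall i A, (F i.+1 -> A) -> F i -> A) : Prop :=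
  [/\ forall i, (i <= n)%N -> natural_operator K (s i),
      forall A, complete chi A -> forall f : F 0%N -> A, equivariant K f ->
        forall v, s 0%N A (fun x => f (cx_d F 0 x)) v = f v &
      forall i, (i < n)%N -> forall A, complete chi A ->
        forall f : F i.+1 -> A, equivariant K f -> forall v,
        s i.+1 A (fun x => f (cx_d F i.+1 x)) v = f v - s i A f (cx_d F i v)].

Lemma equivariant_d K A (C : lmodType ring) (F : complex C) i (f : F i -> A) :
  equivariant K f -> equivariant K (fun x => f (cx_d F i x)).
Proof.
move=> [fB fZ]; split=> [x y|k kK v]; first by rewrite linearB fB.
by rewrite (linearZ_LR (cx_d F i)) fZ.
Qed.

Lemma equivariantB K (F : lmodType ring) A (f g : F -> A) :
  equivariant K f -> equivariant K g -> equivariant K (fun x => f x - g x).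
Proof.
move=> [fB fZ] [gB gZ]; split=> [x y|k kK v].
  by rewrite fB gB !opprD !opprK addrACA.
by rewrite fZ // gZ // scalerBr.
Qed.

(** * The contraction over a subgroup satisfying the Sigma condition *)

Section Base.
Variables (N : groupClosed G) (n : nat).
Local Notation H := (subgroup N).
Local Notation restrN := (restr (subgroup_val_hom N)).
Variables (F : complex (trivial_module G)) (P : complex (trivial_module H)).
Variable phi : forall i, {linear P i -> P i}.
Hypothesis F_exact : is_exact F.
Hypothesis F_proj : forall i, projective (restrN (F i)).
Hypothesis P_exact : is_exact P.
Hypothesis P_proj : forall i, projective (P i).
Hypothesis phi_chain : chain_map n.+1 phi.
Hypothesis solve_ex : forall i A, (i <= n)%N -> complete chi A ->
  forall u : {linear P i -> restrN A},
  exists w : {linear P i -> restrN A}, forall v, w v - w (phi i v) = u v.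
Hypothesis solve_uniq : forall i A, (i <= n)%N -> complete chi A ->
  forall w : {linear P i -> restrN A},
  (forall v, w v = w (phi i v)) -> forall v, w v = 0.

Lemma equivariant_restr (E : lmodType ring) A (f : E -> A) :
  equivariant N f <-> linear (f : restrN E -> restrN A).
Proof.
split=> [[fB fZ]|f_lin].
  apply: equivariant_linear => // k v; rewrite !restrZ; apply/fZ/(valP k).
have fB := linearB (to_linear f_lin); split=> // k kN v.
have := linearZ_LR (to_linear f_lin) (mgen (exist _ k kN : H)) v.
by rewrite !restrZ.
Qed.

Section Solution.
Variables (i : nat) (A : lmodType ring).

(** The cochain [w] with [w (1 - phi) = u], defined on bare functions; the value
    [u] is a default. *)
Definition solution (u : P i -> A) : P i -> A :=
  if pselect (exists w : {linear P i -> restrN A},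
                forall v, w v - w (phi i v) = u v) is left e
  then (projT1 (cid e) : P i -> A) else u.

Hypothesis le_in : (i <= n)%N.
Hypothesis A_complete : complete chi A.

Lemma solutionP (u : {linear P i -> restrN A}) :
  exists w : {linear P i -> restrN A}, solution u = w /\
    forall v, w v - w (phi i v) = u v.
Proof.
rewrite /solution; case: pselect => [e|[]].
  by exists (projT1 (cid e)); split=> //; apply: (projT2 (cid e)).
exact: solve_ex.
Qed.

Lemma solution_eq (u w : {linear P i -> restrN A}) :
  (forall v, w v - w (phi i v) = u v) -> solution u = w.
Proof.
move=> wE; have [w' [-> w'E]] := solutionP u; apply: funext => v.
have [l lE] := linear_sub w' w.
apply: subr0_eq; rewrite -[LHS]lE; apply: (solve_uniq le_in A_complete) => {}v.
have E : w' v - w' (phi i v) = w v - w (phi i v) by rewrite w'E wE.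
rewrite !lE -[w' v](subrK (w' (phi i v))) E.
by rewrite addrAC [w v - _]addrC addrK addrC.
Qed.

End Solution.

(** Let [h] be a homotopy from [1 - phi] to zero on [P], let [al : P -> F] and
    [be : F -> P] be comparison maps over [Z[N]], and let [ka] be a homotopy
    from [1 - al be] to zero.  As composition with [1 - phi] is invertible and
    commutes with the differential, [u |-> u h (1 - phi)^-1] is a contraction of
    the cochains on [P].  It is transported to [F] as
    [f |-> (f al h (1 - phi)^-1) be + f ka]. *)
Lemma base_contraction :
  exists s, contraction N n (F := F) s.
Proof.
have rF_exact := restr_complex_exact (subgroup_val_hom N) F_exact.
set rF := restr_complex (subgroup_val_hom N) F in rF_exact.
have rF_proj i : projective (rF i) := @F_proj i.
have [al [al0 alS]] := chain_map_exists (m := n.+2) (fun i _ => @P_proj i) rF_exact.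
have [be [be0 beS]] := chain_map_exists (m := n.+1) (fun i _ => rF_proj i) P_exact.
have [phi0 phiS] := phi_chain.
have u_ex i : exists u : {linear rF i -> rF i}, forall x, u x = x - al i (be i x).
  have [ab abE] := linear_comp (be i) (al i).
  have [idF idFE] := linear_id (rF i).
  have [u uE] := linear_sub idF ab.
  by exists u => x; rewrite uE abE idFE.
pose u i := projT1 (cid (u_ex i)).
have uE i x : u i x = x - al i (be i x) by apply: (projT2 (cid (u_ex i))).
have w_ex i : exists w : {linear P i -> P i}, forall x, w x = x - phi i x.
  have [idP idPE] := linear_id (P i).
  have [w wE] := linear_sub idP (phi i).
  by exists w => x; rewrite wE idPE.
pose w i := projT1 (cid (w_ex i)).
have wE i x : w i x = x - phi i x by apply: (projT2 (cid (w_ex i))).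
have [||ka [ka0 kaS]] := homotopy_exists (m := n) (u := u)
    (fun i _ => rF_proj i) rF_exact.
- by move=> x; rewrite uE linearB al0 be0 subrr.
- move=> i lt_in x; have lt_in1 := leqW lt_in; have lt_in2 := leqW lt_in1.
  by rewrite !uE linearB (alS _ lt_in2) (beS _ lt_in1).
have [||h [h0 hS]] := homotopy_exists (m := n) (u := w)
    (fun i _ => @P_proj i) P_exact.
- by move=> x; rewrite wE linearB phi0 subrr.
- by move=> i lt_in x; rewrite !wE linearB (phiS _ (leqW lt_in)).
pose s i A (f : F i.+1 -> A) (v : F i) : A :=
  solution (fun p => f (al i.+1 (h i p))) (be i v) + f (ka i v).
have fah i A (f : F i.+1 -> A) : equivariant N f ->
    exists g : {linear P i -> restrN A}, (g : P i -> A) = (fun p => f (al i.+1 (h i p))).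
  move=> /equivariant_restr f_lin.
  have [ah ahE] := linear_comp (h i) (al i.+1).
  have [g gE] := linear_comp ah (to_linear f_lin).
  by exists g; apply: funext => p; rewrite gE ahE.
exists s; split=> [i le_in||i lt_in].
- split=> [A A_c f f_eqv|A A_c f g f_eqv g_eqv v|A A' q A_c A'_c f f_eqv v].
  + apply/equivariant_restr; have [g gE] := fah i A f f_eqv.
    have [w' [w'E _]] := solutionP le_in A_c g.
    have [wb wbE] := linear_comp (be i) w'.
    have f_lin := f_eqv; move/equivariant_restr in f_lin.
    have [fk fkE] := linear_comp (ka i) (to_linear f_lin).
    have [r rE] := linear_add wb fk.
    suff -> : s i A f = r by apply: linearP.
    by apply: funext => v; rewrite rE wbE fkE /s -gE w'E.
  + have [f' f'E] := fah i A f f_eqv; have [g' g'E] := fah i A g g_eqv.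
    have [w1 [w1E w1P]] := solutionP le_in A_c f'.
    have [w2 [w2E w2P]] := solutionP le_in A_c g'.
    have [w3 w3E] := linear_sub w1 w2.
    have [fg fgE] := linear_sub f' g'.
    rewrite /s -f'E -g'E w1E w2E.
    have -> : (fun p => f (al i.+1 (h i p)) - g (al i.+1 (h i p))) = fg.
      by apply: funext => p; rewrite fgE f'E g'E.
    rewrite (solution_eq le_in A_c (w := w3)) => [|p].
      by rewrite w3E opprD addrACA.
    rewrite !w3E fgE -w1P -w2P !opprD !opprK.
    by rewrite addrACA.
  have [f' f'E] := fah i A f f_eqv.
  have [w1 [w1E w1P]] := solutionP le_in A_c f'.
  have [qw qwE] := linear_comp w1 (to_linear (restr_linear (phi_hom := subgroup_val_hom N) q)).
  have [qf qfE] := linear_comp f' (to_linear (restr_linear (phi_hom := subgroup_val_hom N) q)).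
  rewrite /s -f'E w1E linearD; congr (_ + _).
  have -> : (fun p => q (f (al i.+1 (h i p)))) = qf.
    by apply: funext => p; rewrite qfE f'E.
  rewrite (solution_eq le_in A'_c (w := qw)) ?qwE // => p.
  by rewrite !qwE qfE -w1P linearB.
- move=> A A_c f f_eqv v; have [fB _] := f_eqv.
  have f_lin := f_eqv; move/equivariant_restr in f_lin.
  have [g gE] := fah 0%N A _ (equivariant_d f_eqv).
  have [fa faE] := linear_comp (al 0%N) (to_linear f_lin).
  rewrite /s -gE (solution_eq (leq0n n) A_c (w := fa)) => [|p].
    by rewrite faE [cx_d F 0 _]ka0 uE to_linearE fB addrC subrK.
  by rewrite -linearB -wE -h0 faE -alS // gE.
move=> A A_c f f_eqv v; have [fB _] := f_eqv.
have f_lin := f_eqv; move/equivariant_restr in f_lin.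
have [g gE] := fah i.+1 A _ (equivariant_d f_eqv).
have [f' f'E] := fah i A f f_eqv.
have [w1 [w1E w1P]] := solutionP (ltnW lt_in) A_c f'.
have [w1d w1dE] := linear_comp (cx_d P i) w1.
have [fa faE] := linear_comp (al i.+1) (to_linear f_lin).
have [w2 w2E] := linear_sub fa w1d.
rewrite /s -gE -f'E w1E (solution_eq lt_in A_c (w := w2)) => [|p].
  rewrite w2E w1dE faE [cx_d F i.+1 _]kaS // fB uE to_linearE.
  rewrite -(beS i (leqW lt_in)) opprD addrACA.
  by rewrite fB [f (al _ _) + _]addrC subrK.
rewrite !w2E !w1dE (phiS i (leqW lt_in)) opprD opprK addrACA.
have -> : - w1 (cx_d P i p) + w1 (phi i (cx_d P i p)) = - f' (cx_d P i p).
  by rewrite -w1P opprB addrC.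
have <- : f (al i.+1 (cx_d P i.+1 (h i.+1 p))) = g p.
  by rewrite gE -alS // leqW.
rewrite hS // f'E (linearB (al i.+1)) [in RHS]fB wE (linearB (al i.+1)).
by rewrite [in RHS]fB !faE !to_linearE.
Qed.

End Base.
End Contractions.

(** * Passing from a normal subgroup to the group *)

Section Averaging.
Variables (R : realType) (G : groupType) (chi : real_hom R G).
Local Notation ring := (monoid_ring G).
Variables N K : groupClosed G.
Hypothesis N_normal : normal_in N K.
Implicit Types A E : lmodType ring.

Section Conjugate.
Variables F A : lmodType ring.
Implicit Types f : F -> A.

Definition conjugate (k : G) f (v : F) : A := mgen k *: f (mgen k^-1%g *: v).

Lemma conjugateM k l f : conjugate (k * l)%g f = conjugate k (conjugate l f).
Proof.
by apply: funext => v; rewrite /conjugate invgM !mgenM !scalerA.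
Qed.

Lemma conjugate1 f : conjugate 1%g f = f.
Proof.
by apply: funext => v; rewrite /conjugate invg1 !mgen1 !scale1r.
Qed.

Lemma conjugateK k f : conjugate k (conjugate k^-1%g f) = f.
Proof. by rewrite -conjugateM mulgV conjugate1. Qed.

Lemma conjugate_fixed (H : groupClosed G) k f :
  equivariant H f -> k \in H -> conjugate k f = f.
Proof.
move=> [_ fZ] kH; apply: funext => v; rewrite /conjugate fZ ?gpredV //.
by rewrite scalerA -mgenM mulgV mgen1 scale1r.
Qed.

Lemma conjugate_equivariant k f :
  k \in K -> equivariant N f -> equivariant N (conjugate k f).
Proof.
move=> kK [fB fZ]; split=> [x y|n nN v].
  by rewrite /conjugate scalerBr fB scalerBr.
have nkN : (n ^ k)%g \in N by apply: N_normal.2.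
rewrite /conjugate [X in f X]scalerA -[X in f (X *: _)]mgenM.
have -> : (k^-1 * n = n ^ k * k^-1)%g by rewrite conjgE mulgA mulgK.
by rewrite mgenM -scalerA fZ // scalerA -mgenM conjgE mulgA mulgV mul1g mgenM scalerA.
Qed.

End Conjugate.

Section Average.
Variables (E : lmodType ring) (Y : choiceType).
Variable s : forall A : lmodType ring, (E -> A) -> freemod G Y -> A.

(** Although a sum over [K / N] need not be finite, [s] can be made equivariant
    under [K]: at the basis element [(g, x)] use the conjugate of [s] by the
    part [k] of [g] in [K], where [g] is [k] times the representative of its
    coset [K g]. *)
Definition average (A : lmodType ring) (f : E -> A) : freemod G Y -> A :=
  ext_int (fun u => let k := coset_part K u.1 in
    conjugate k (s (conjugate k^-1%g f)) (fbas u.1 u.2)).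

Lemma averageU A (f : E -> A) g x (k := coset_part K g) :
  average f (fbas g x) = conjugate k (s (conjugate k^-1%g f)) (fbas g x).
Proof. exact: ext_intU. Qed.

Lemma averageB A (f : E -> A) : {morph average f : v w / v - w}.
Proof. exact: ext_intB. Qed.

(** The part in [K] of [k g] is [k] times that of [g]; hence the average commutes
    with conjugation by [K], whatever [s] is. *)
Lemma average_conjugate A (f : E -> A) k :
  k \in K -> average (conjugate k f) = conjugate k (average f).
Proof.
move=> kK; apply: funext; apply: (freemod_eq (M := G) (X := Y)) => [|v w|g x].
- exact: averageB.
- by rewrite /conjugate scalerBr averageB scalerBr.
rewrite averageU [RHS]/conjugate fbasZ averageU coset_partM ?gpredV //.
set h := coset_part K g.
rewrite -fbasZ -[RHS]/(conjugate k (conjugate (k^-1 * h)%g _) _).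
by rewrite -!conjugateM (invgM k^-1%g h) invgK mulgA mulgV mul1g.
Qed.

(** Averaging does not disturb a value [th] that [s] takes in a [K]-equivariant
    way. *)
Lemma average_fixed A (f : E -> A) (th : freemod G Y -> A) :
  {morph th : v w / v - w} ->
  (forall k, k \in K -> s (conjugate k f) = conjugate k th) -> average f = th.
Proof.
move=> thB sf; apply: funext; apply: (freemod_eq (M := G) (X := Y)) => // [|g x].
  exact: averageB.
by rewrite averageU sf ?gpredV ?coset_part_in // conjugateK.
Qed.

(** Equivariance under [N] follows from [average_conjugate], as [N] acts trivially
    on the [N]-equivariant cochains. *)
Lemma average_natural :
  natural_operator chi N s -> natural_operator chi N average.
Proof.
move=> [s_eqv s_B s_nat].
have kV g : (coset_part K g)^-1%g \in K by rewrite gpredV coset_part_in.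
split=> [A A_c f f_eqv|A A_c f g f_eqv g_eqv|A A' q A_c A'_c f f_eqv].
- split=> [|n nN v]; first exact: averageB.
  have nK := N_normal.1 n nN.
  have E0 : conjugate n (average f) = average f.
    by rewrite -average_conjugate // (conjugate_fixed f_eqv nN).
  rewrite -[in LHS]E0 /conjugate scalerA -mgenM mulVg mgen1 scale1r.
  by [].
- apply: (freemod_eq (M := G) (X := Y)) => [|v w|u x].
  + exact: averageB.
  + by rewrite !averageB !opprD !opprK addrACA.
  rewrite !averageU /conjugate -scalerBr; congr (_ *: _).
  rewrite -s_B //; try exact: conjugate_equivariant.
  congr (s _ _); apply: funext => v.
  by rewrite scalerBr.
apply: (freemod_eq (M := G) (X := Y)) => [|v w|u x].
- exact: averageB.
- by rewrite averageB linearB.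
rewrite !averageU /conjugate linearZ_LR; congr (_ *: _).
rewrite -s_nat //; last exact: conjugate_equivariant.
by congr (s _ _); apply: funext => v; rewrite linearZ_LR.
Qed.

End Average.

Section Step.
Variables (C : lmodType ring) (X : nat -> choiceType).
Variable d : forall i, {linear freemod G (X i.+1) -> freemod G (X i)}.
Variable e : {linear freemod G (X 0%N) -> C}.
Hypothesis ed : forall x, e (d 0 x) = 0.
Hypothesis dd : forall i x, d i (d i.+1 x) = 0.
Local Notation F := (@Complex _ C (fun i => freemod G (X i)) d e ed dd).
Variable n : nat.
Variable s : forall i (A : lmodType ring),
  (freemod G (X i.+1) -> A) -> freemod G (X i) -> A.
Hypothesis s_contr : contraction chi N n (F := F) s.

(** The operators [s] contract, but averaging them destroys the identities between
    successive degrees.  So before averaging, [s] in degree [i + 1] is replaced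
    by [(1 - d^* a) s], where [a] is the averaged operator of degree [i] and
    [d^*] is composition with the differential. *)
Fixpoint averaged i :
    forall A : lmodType ring, (freemod G (X i.+1) -> A) -> freemod G (X i) -> A :=
  match i with
  | 0 => average (s (i := 0))
  | i'.+1 => average (fun A (f : freemod G (X i'.+2) -> A) v =>
      s (i := i'.+1) f v - averaged (s (i := i'.+1) f) (d i' v))
  end.

Definition corrected i (A : lmodType ring) (f : freemod G (X i.+2) -> A) v :=
  s (i := i.+1) f v - averaged (s (i := i.+1) f) (d i v).

Lemma averagedS i : averaged (i := i.+1) = average (@corrected i).
Proof. by []. Qed.

Lemma corrected_natural i :
  natural_operator chi N (s (i := i.+1)) ->
  natural_operator chi N (averaged (i := i)) ->
  natural_operator chi N (@corrected i).
Proof.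
move=> [s_eqv s_B s_nat] [a_eqv a_B a_nat].
split=> [A A_c f f_eqv|A A_c f g f_eqv g_eqv v|A A' q A_c A'_c f f_eqv v].
- apply: equivariantB; first exact: s_eqv.
  have [aB aZ] := a_eqv A A_c _ (s_eqv A A_c f f_eqv).
  split=> [x y|k kN v]; first by rewrite linearB aB.
  by rewrite linearZ_LR aZ.
- rewrite /corrected s_B //.
  have -> : s (i := i.+1) (fun x => f x - g x) =
      (fun x => s (i := i.+1) f x - s (i := i.+1) g x).
    by apply: funext => x; rewrite s_B.
  rewrite a_B //; try exact: s_eqv.
  by rewrite !opprD !opprK addrACA.
rewrite /corrected s_nat // linearB; congr (_ - _).
have -> : s (i := i.+1) (fun x => q (f x)) = (fun x => q (s (i := i.+1) f x)).
  by apply: funext => x; rewrite s_nat.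
by rewrite a_nat //; apply: s_eqv.
Qed.

Lemma averaged_natural i : (i <= n)%N -> natural_operator chi N (averaged (i := i)).
Proof.
have [s_nat _ _] := s_contr.
elim: i => [|i IH] le_in; apply: average_natural; first exact: s_nat.
by apply: corrected_natural; [exact: s_nat|exact/IH/ltnW].
Qed.

Lemma averaged_conjugate i A (f : freemod G (X i.+1) -> A) k :
  k \in K -> averaged (conjugate k f) = conjugate k (averaged f).
Proof. by case: i f => [|i] f; apply: average_conjugate. Qed.

Lemma conjugate_d i A (f : freemod G (X i) -> A) k :
  conjugate k (fun v => f (d i v)) = (fun v => conjugate k f (d i v)).
Proof. by apply: funext => v; rewrite /conjugate linearZ_LR. Qed.

Lemma averaged_0 A (f : freemod G (X 0) -> A) :
  complete chi A -> equivariant N f -> averaged (fun v => f (d 0 v)) = f.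
Proof.
have [_ s0 _] := s_contr => A_c f_eqv.
apply: average_fixed => [|k kK]; first by case: f_eqv.
rewrite conjugate_d; apply: funext => v; apply: s0 => //.
exact: conjugate_equivariant.
Qed.

(** With [a] the averaged operator of degree [i],
    [(1 - d^* a) s d^* = (1 - d^* a) (1 - d^* s) = 1 - d^* a - d^* s + d^* a d^* s],
    and the last two terms cancel because [d^* a d^*] and [d^*] agree: this is
    the hypothesis [key].  The result [1 - d^* a] is [K]-equivariant, so that
    averaging leaves it unchanged. *)
Lemma averaged_S_step i A (f : freemod G (X i.+1) -> A) :
  (i < n)%N -> complete chi A -> equivariant N f ->
  (forall g : freemod G (X i) -> A, equivariant N g ->
     forall v, averaged (fun v => g (d i v)) (d i v) = g (d i v)) ->
  averaged (fun v => f (d i.+1 v)) = (fun v => f v - averaged f (d i v)).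
Proof.
have [s_nat s0 sS] := s_contr => lt_in A_c f_eqv key.
have le_in := ltnW lt_in; have [a_eqv a_B _] := averaged_natural le_in.
have [s_eqv _ _] := s_nat i le_in.
have a_f := a_eqv A A_c f f_eqv.
rewrite averagedS; apply: average_fixed => [x y|k kK].
  by rewrite linearB a_f.1 f_eqv.1 !opprD !opprK addrACA.
have fk_eqv := conjugate_equivariant kK f_eqv.
rewrite conjugate_d; apply: funext => v; rewrite /corrected.
have -> : s (i := i.+1) (fun v => conjugate k f (d i.+1 v)) =
    (fun v => conjugate k f v - s (i := i) (conjugate k f) (d i v)).
  by apply: funext => x; apply: sS.
rewrite a_B //; last exact/(@equivariant_d _ _ _ _ F)/s_eqv.
rewrite key; last exact: s_eqv.
rewrite averaged_conjugate // opprB addrA subrK.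
by rewrite /conjugate scalerBr (linearZ_LR (d i)).
Qed.

Lemma averaged_S i A (f : freemod G (X i.+1) -> A) :
  (i < n)%N -> complete chi A -> equivariant N f ->
  averaged (fun v => f (d i.+1 v)) = (fun v => f v - averaged f (d i v)).
Proof.
elim: i f => [|i IH] f lt_in A_c f_eqv; apply: averaged_S_step => // g g_eqv v.
  by rewrite averaged_0.
have lt_in' := ltnW lt_in; rewrite IH // dd.
have [a_eqv _ _] := averaged_natural (ltnW lt_in').
by rewrite (morphB_0 (a_eqv A A_c g g_eqv).1) subr0.
Qed.

Lemma averaged_contraction : contraction chi K n (F := F) averaged.
Proof.
have KN A E (f : E -> A) : equivariant K f -> equivariant N f.
  by move=> [fB fZ]; split=> // k kN; apply/fZ/N_normal.1.
split=> [i le_in|A A_c f f_eqv v|i lt_in A A_c f f_eqv v].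
- have [a_eqv a_B a_nat] := averaged_natural le_in.
  split=> [A A_c f f_eqv|A A_c f g f_eqv g_eqv|A A' q A_c A'_c f f_eqv].
  + split=> [|k kK v]; first exact: (a_eqv A A_c f (KN _ _ _ f_eqv)).1.
    rewrite -{1}(conjugate_fixed f_eqv kK) averaged_conjugate // /conjugate.
    by rewrite [X in averaged _ X]scalerA -mgenM mulVg mgen1 scale1r.
  + by apply: a_B => //; apply: KN.
  + by apply: a_nat => //; apply: KN.
- by rewrite averaged_0 //; apply: KN.
by rewrite averaged_S //; apply: KN.
Qed.

End Step.
End Averaging.

(** * Quotient modules *)

Section Quotient.
Variables (R : pzRingType) (A : lmodType R) (S : A -> Prop).

(** Elements of the quotient are represented by a canonical choice in each class. *)
Definition quot_rep of is_submodule S := fun x : A =>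
  choose (fun y => `[<S (y - x)>]) x.
Definition quotient (S_sub : is_submodule S) := {x : A | quot_rep S_sub x == x}.

Variable S_sub : is_submodule S.

HB.instance Definition _ := [Choice of quotient S_sub by <:].

Lemma submoduleN x : S x -> S (- x).
Proof. by case: S_sub => S0 SD Sx; rewrite -scaleN1r -[_ *: _]addr0; apply: SD. Qed.

Lemma submoduleD x y : S x -> S y -> S (x + y).
Proof. by case: S_sub => _ SD Sx Sy; rewrite -[x]scale1r; apply: SD. Qed.

Lemma submoduleZ a x : S x -> S (a *: x).
Proof. by case: S_sub => S0 SD Sx; rewrite -[_ *: _]addr0; apply: SD. Qed.

Lemma quot_repP x : S (quot_rep S_sub x - x).
Proof.
apply/asboolP; apply: (chooseP (P := fun y => `[<S (y - x)>])).
by apply/asboolP; rewrite subrr; case: S_sub.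
Qed.

Lemma quot_rep_eq x y : S (x - y) -> quot_rep S_sub x = quot_rep S_sub y.
Proof.
move=> Sxy; rewrite /quot_rep.
have PE : (fun z => `[<S (z - x)>]) =1 (fun z => `[<S (z - y)>]).
  move=> z; apply: asbool_equiv_eq; split=> Sz.
    by rewrite -[z](subrK x) -addrA; apply: submoduleD.
  rewrite -[z](subrK y) -addrA; apply: submoduleD => //.
  by rewrite -opprB; apply: submoduleN.
rewrite (eq_choose PE); apply: choose_id.
  exact/asboolP.
by apply/asboolP; rewrite subrr; case: S_sub.
Qed.

Lemma quot_repK x : quot_rep S_sub (quot_rep S_sub x) == quot_rep S_sub x.
Proof. by apply/eqP/quot_rep_eq/quot_repP. Qed.

Definition quot_class (x : A) : quotient S_sub := exist _ (quot_rep S_sub x) (quot_repK x).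

Lemma quot_class_eq x y : S (x - y) -> quot_class x = quot_class y.
Proof. by move=> Sxy; apply: val_inj; apply: quot_rep_eq. Qed.

Lemma quot_classK (u : quotient S_sub) : quot_class (val u) = u.
Proof. by apply: val_inj; apply/eqP/(valP u). Qed.

Lemma quot_class_val x : S (val (quot_class x) - x).
Proof. exact: quot_repP. Qed.

Definition quot_add (u v : quotient S_sub) := quot_class (val u + val v).
Definition quot_opp (u : quotient S_sub) := quot_class (- val u).
Definition quot_scale a (u : quotient S_sub) := quot_class (a *: val u).

Lemma quot_addE x y :
  quot_add (quot_class x) (quot_class y) = quot_class (x + y).
Proof.
apply: quot_class_eq; rewrite opprD addrACA.
by apply: submoduleD; apply: quot_class_val.
Qed.

Lemma quot_oppE x : quot_opp (quot_class x) = quot_class (- x).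
Proof.
by apply: quot_class_eq; rewrite -opprD; apply/submoduleN/quot_class_val.
Qed.

Lemma quot_scaleE a x : quot_scale a (quot_class x) = quot_class (a *: x).
Proof.
by apply: quot_class_eq; rewrite -scalerBr; apply/submoduleZ/quot_class_val.
Qed.

Lemma quot_addA : associative quot_add.
Proof.
move=> u v w; rewrite -[u]quot_classK -[v]quot_classK -[w]quot_classK.
by rewrite !quot_addE addrA.
Qed.

Lemma quot_addC : commutative quot_add.
Proof. by move=> u v; rewrite /quot_add addrC. Qed.

Lemma quot_add0 : left_id (quot_class 0) quot_add.
Proof. by move=> u; rewrite -[u]quot_classK quot_addE add0r. Qed.

Lemma quot_addN : left_inverse (quot_class 0) quot_opp quot_add.
Proof. by move=> u; rewrite -[u]quot_classK quot_oppE quot_addE addNr. Qed.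

HB.instance Definition _ := GRing.isZmodule.Build (quotient S_sub)
  quot_addA quot_addC quot_add0 quot_addN.

Lemma quot_scaleA a b u : quot_scale a (quot_scale b u) = quot_scale (a * b) u.
Proof. by rewrite -[u]quot_classK !quot_scaleE scalerA. Qed.

Lemma quot_scale1 : left_id 1 quot_scale.
Proof. by move=> u; rewrite -[u]quot_classK quot_scaleE scale1r. Qed.

Lemma quot_scaleDr : right_distributive quot_scale +%R.
Proof.
move=> a u v; rewrite -[u]quot_classK -[v]quot_classK.
by rewrite [_ + _]quot_addE !quot_scaleE scalerDr [RHS]quot_addE.
Qed.

Lemma quot_scaleDl u : {morph quot_scale^~ u : a b / a + b}.
Proof.
move=> a b; rewrite -[u]quot_classK !quot_scaleE scalerDl.
by rewrite [RHS]quot_addE.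
Qed.

HB.instance Definition _ := GRing.Zmodule_isLmodule.Build R (quotient S_sub)
  quot_scaleA quot_scale1 quot_scaleDr quot_scaleDl.

Lemma quot_class_linear : linear quot_class.
Proof.
move=> a x y; rewrite -[RHS]/(quot_add (quot_scale a _) _).
by rewrite quot_scaleE quot_addE.
Qed.

Definition quot_pi : {linear A -> quotient S_sub} := to_linear quot_class_linear.

Lemma quot_pi_eq x y : quot_pi x = quot_pi y <-> S (x - y).
Proof.
split=> [/(congr1 val) E|]; last exact: quot_class_eq.
rewrite -[x](subrK (quot_rep S_sub x)) -addrA; apply: submoduleD.
  by rewrite -opprB; apply/submoduleN/quot_repP.
by rewrite [quot_rep S_sub x]E; apply: quot_repP.
Qed.

Lemma quot_pi_eq0 x : quot_pi x = 0 <-> S x.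
Proof. by rewrite -(linear0 quot_pi) quot_pi_eq subr0. Qed.

Lemma quot_piK (u : quotient S_sub) : quot_pi (val u) = u.
Proof. exact: quot_classK. Qed.

End Quotient.

(** * Completion of a filtered module *)

Section Completion.
Variables (R : realType) (G : groupType) (chi : real_hom R G).
Local Notation ring := (monoid_ring G).
Implicit Types V W : lmodType ring.

(** [ge r x] means that the valuation of [x] is at least [r]. *)
Record filtration V (ge : R -> V -> Prop) : Prop := Filtration {
  ge0 : forall r, ge r 0;
  geB : forall r x y, ge r x -> ge r y -> ge r (x - y);
  ge_le : forall r r' x, r <= r' -> ge r' x -> ge r x;
  ge_ex : forall x, exists r, ge r x;
  geZ : forall r g x, ge r x -> ge (r + chi g) (mgen g *: x) }.

Section OneModule.
Variables (V : lmodType ring) (ge : R -> V -> Prop).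
Hypothesis ge_filt : filtration ge.

Definition null_seq (x : nat -> V) : Prop :=
  forall r, exists p0, forall p, (p0 <= p)%N -> ge r (x p).

Lemma null_submodule : is_submodule null_seq.
Proof.
apply: mgen_closed => [r|x y xn yn r|k x xn r].
- by exists 0%N => p _; apply: ge0.
- have [p1 p1P] := xn r; have [p2 p2P] := yn r; exists (maxn p1 p2) => p.
  by rewrite geq_max => /andP[/p1P xp /p2P yp]; apply: geB.
have [p0 p0P] := xn (r - chi k); exists p0 => p /p0P xp.
by rewrite -[r](subrK (chi k)); apply: geZ.
Qed.

(** Sequences modulo null sequences.  The sequences are arbitrary: for each index
    a partial sum of a geometric series may be taken as long as that entry
    demands. *)
Definition completion : lmodType ring := quotient null_submodule.

Definition to_completion : V -> completion :=
  fun v => quot_pi null_submodule (fun=> v).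

Lemma to_completion_linear : linear to_completion.
Proof. by move=> a x y; rewrite /to_completion -linearP. Qed.

Lemma geN r x : ge r x -> ge r (- x).
Proof. by move=> xr; rewrite -[- x]add0r; apply: geB => //; apply: ge0. Qed.

Lemma geD r x y : ge r x -> ge r y -> ge r (x + y).
Proof. by move=> xr yr; rewrite -[y]opprK; apply: geB => //; apply: geN. Qed.

Lemma ge_common (X : choiceType) (m : X -> V) :
  finite_basis X -> exists r, forall x, ge r (m x).
Proof.
move=> [l lP]; suff [r rP] : exists r, forall x, x \in l -> ge r (m x).
  by exists r => x; apply/rP/lP.
elim: l {lP} => [|y l [r rP]]; first by exists 0.
have [r' r'P] := ge_ex ge_filt (m y); exists (Num.min r r') => x.
rewrite inE => /orP[/eqP ->|/rP xr].
  by apply: (ge_le ge_filt _ r'P); rewrite ge_min lexx orbT.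
by apply: (ge_le ge_filt _ xr); rewrite ge_min lexx.
Qed.

Section System.
Variables (X : choiceType) (s : X -> seq (int * G * X)).
Hypothesis X_fin : finite_basis X.
Hypothesis s_pos : positive_system chi s.

(** The support of a matrix is finite, so a positive [chi] is bounded below on it. *)
Lemma positive_gap : exists2 eps : R, 0 < eps &
  forall x u, u \in s x -> eps <= chi u.1.2.
Proof.
have [l lP] := X_fin.
suff [eps eps0 epsP] : exists2 eps : R, 0 < eps &
    forall u, u \in flatten (map s l) -> eps <= chi u.1.2.
  exists eps => // x u us; apply: epsP; apply/flattenP; exists (s x) => //.
  exact/map_f/lP.
have : forall u, u \in flatten (map s l) -> 0 < chi u.1.2.
  by move=> u /flattenP[_ /mapP[x _ ->]]; apply: s_pos.
elim: (flatten _) => [|u l' IH] l'P; first by exists 1.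
have [|eps eps0 epsP] := IH.
  by move=> v vl'; apply: l'P; rewrite inE vl' orbT.
exists (Num.min eps (chi u.1.2)).
  by rewrite lt_min eps0 l'P // inE eqxx.
move=> v; rewrite inE => /orP[/eqP ->|/epsP v_eps]; rewrite ge_min ?lexx ?orbT //.
by rewrite v_eps.
Qed.

Lemma combination_ge eps r (m : X -> V) :
  (forall x u, u \in s x -> eps <= chi u.1.2) ->
  (forall x, ge r (m x)) -> forall x, ge (r + eps) (combination s m x).
Proof.
move=> epsP mr x; rewrite /combination big_seq.
elim/big_ind: _ => [|u v|u us]; [exact: ge0|exact: geD|].
apply: (subgroup_mulz (S := ge (r + eps))); [exact: ge0|exact: geB|].
apply: (ge_le ge_filt (r' := r + chi u.1.2)); last exact: geZ.
by rewrite lerD2l; apply: epsP us.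
Qed.

Lemma combinationD (A : lmodType ring) (m m' : X -> A) x :
  combination s (fun y => m y + m' y) x = combination s m x + combination s m' x.
Proof.
by rewrite -big_split; apply: eq_bigr => u _; rewrite /= scalerDr mulrzDl.
Qed.

Lemma combinationB (A : lmodType ring) (m m' : X -> A) x :
  combination s (fun y => m y - m' y) x = combination s m x - combination s m' x.
Proof.
by rewrite -sumrB; apply: eq_bigr => u _; rewrite /= scalerBr mulrzBl.
Qed.

Lemma combination_linear (A B : lmodType ring) (f : {linear A -> B}) m x :
  f (combination s m x) = combination s (fun y => f (m y)) x.
Proof.
by rewrite linear_sum; apply: eq_bigr => u _; rewrite raddfMz /= linearZ_LR.
Qed.

Lemma combination_at (m : X -> nat -> V) x p :
  combination s m x p = combination s (fun y => m y p) x.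
Proof.
have ev_lin : linear (fun z : nat -> V => z p) by [].
exact: (combination_linear (to_linear ev_lin)).
Qed.

(** The partial sum [m + T m + ... + T^(k-1) m] of the geometric series of the
    matrix [T] of [s]. *)
Definition partial_solution (m : X -> V) k : X -> V :=
  iter k (fun w x => m x + combination s w x) (fun=> 0).

Lemma partial_solutionE m k x :
  partial_solution m k x - combination s (partial_solution m k) x =
  m x - iter k (fun w => combination s w) m x.
Proof.
elim: k x => [|k IH] x.
  by rewrite /= /combination big1 ?subrr ?subr0 // => u _; rewrite scaler0 mul0rz.
have E : iter k (fun w => combination s w) m =
    (fun y => m y - (partial_solution m k y - combination s (partial_solution m k) y)).
  by apply: funext => y; rewrite IH subKr.
rewrite /= -/(partial_solution m k) combinationD [in RHS]E.
by rewrite !combinationB opprB opprD addrACA -addrA [- _ + (_ - _)]addrC.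
Qed.

Lemma iter_combination_ge eps r (m : X -> V) k :
  (forall x u, u \in s x -> eps <= chi u.1.2) ->
  (forall x, ge r (m x)) ->
  forall x, ge (r + eps *+ k) (iter k (fun w => combination s w) m x).
Proof.
move=> epsP mr; elim: k => [|k IH] x; first by rewrite mulr0n addr0.
by rewrite mulrSr addrA /=; apply: combination_ge.
Qed.

(** A representing sequence is solved entry by entry: at the entry of index [p],
    sum the geometric series until the error has valuation at least [p]. *)
Lemma system_solvable (m : X -> completion) :
  exists m', forall x, m' x - combination s m' x = m x.
Proof.
have [eps eps0 epsP] := positive_gap.
have k_ex p : exists k, forall x,
    ge p%:R (iter k (fun w => combination s w) (fun y => val (m y) p) x).
  have [r rP] := ge_common (fun y => val (m y) p) X_fin.
  have [k kP] := archimedean_mulrn (p%:R - r) eps0.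
  exists k => x; apply: (ge_le ge_filt (r' := r + eps *+ k)).
    by rewrite -lerBlDl.
  exact: iter_combination_ge.
have [k kP] := choice k_ex.
pose m' x p := partial_solution (fun y => val (m y) p) (k p) x.
exists (fun x => quot_pi null_submodule (m' x)) => x.
rewrite -combination_linear -linearB -[RHS]quot_piK; apply/quot_pi_eq => r.
exists (Num.truncn r).+1 => p lt_p.
suff -> : (m' x - combination s m' x - val (m x)) p =
   - iter (k p) (fun w => combination s w) (fun y => val (m y) p) x.
  apply: geN; apply: (ge_le ge_filt (r' := p%:R)); last exact: kP.
  by rewrite (le_trans (ltW (truncnS_gt _))) // ler_nat.
rewrite -[LHS]/(m' x p - combination s m' x p - val (m x) p) combination_at.
by rewrite [X in X - _]partial_solutionE addrAC subrr sub0r.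
Qed.

(** If [m - T m] has valuation at least [r] from some index on, then so has [m]:
    each use of [m = (m - T m) + T m] improves the bound by [eps], up to [r]. *)
Lemma system_unique (m : X -> completion) :
  (forall x, m x = combination s m x) -> forall x, m x = 0.
Proof.
have [eps eps0 epsP] := positive_gap; move=> mE.
pose m' x := val (m x).
have m'E x : null_seq (m' x - combination s m' x).
  apply/(quot_pi_eq null_submodule); rewrite combination_linear quot_piK mE.
  by congr (combination s _ x); apply: funext => y; rewrite quot_piK.
suff m'_null x : null_seq (m' x).
  by move=> x; rewrite -[m x]quot_piK; apply/quot_pi_eq0/m'_null.
move=> r.
have [p0 p0P] : exists p0, forall p, (p0 <= p)%N ->
    forall y, ge r (m' y p - combination s (fun z => m' z p) y).
  have [p0 p0P] := choice (fun y => m'E y r).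
  have [l lP] := X_fin.
  exists (\max_(y <- l) p0 y)%N => p le_p y; rewrite -combination_at.
  by apply: p0P; apply: leq_trans le_p; apply: leq_bigmax_seq.
exists p0 => p /p0P eP.
have [r0 r0P] := ge_common (fun y => m' y p) X_fin.
have [k kP] : exists k, r <= r0 + eps *+ k.
  by have [k kP] := archimedean_mulrn (r - r0) eps0; exists k; rewrite -lerBlDl.
suff : forall y, ge (Num.min r (r0 + eps *+ k)) (m' y p).
  by move=> /(_ x); apply: (ge_le ge_filt); rewrite le_min lexx.
elim: k {kP} => [|k IH] y.
  apply: (ge_le ge_filt (r' := r0)); last exact: r0P.
  by rewrite mulr0n addr0 ge_min lexx orbT.
rewrite -[m' y p](subrK (combination s (fun z => m' z p) y)); apply: geD.
  by apply: (ge_le ge_filt (r' := r)); [rewrite ge_min lexx|exact: eP].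
have cg := combination_ge epsP IH y; apply: (ge_le ge_filt _ cg).
rewrite mulrSr addrA addr_minl le_min; apply/andP; split; last first.
  by rewrite ge_min lexx orbT.
by rewrite ge_min lerDl ltW.
Qed.

End System.

Lemma completion_complete : complete chi completion.
Proof.
by move=> X s X_fin s_pos; split; [exact: system_solvable|exact: system_unique].
Qed.

End OneModule.

Section Functoriality.
Variables (V W : lmodType ring) (ge : R -> V -> Prop) (ge' : R -> W -> Prop).
Hypotheses (ge_filt : filtration ge) (ge'_filt : filtration ge').
Variable f : {linear V -> W}.
Hypothesis f_ge : forall r x, ge r x -> ge' r (f x).

Lemma completion_map : exists F : {linear completion ge_filt -> completion ge'_filt},
  forall x : nat -> V, F (quot_pi (null_submodule ge_filt) x) =
    quot_pi (null_submodule ge'_filt) (f \o x).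
Proof.
pose F (u : completion ge_filt) : completion ge'_filt :=
  quot_pi (null_submodule ge'_filt) (f \o val u).
have FE x : F (quot_pi (null_submodule ge_filt) x) =
    quot_pi (null_submodule ge'_filt) (f \o x).
  apply/(quot_pi_eq (null_submodule ge'_filt)) => r.
  have /(_ r)[p0 p0P] : null_seq ge (val (quot_pi (null_submodule ge_filt) x) - x).
    by apply/(quot_pi_eq (null_submodule ge_filt)); rewrite quot_piK.
  exists p0 => p /p0P/f_ge.
  by rewrite [f _]linearB.
have F_lin : linear F.
  move=> a u v; rewrite -[u]quot_piK -[v]quot_piK -linearP !FE.
  rewrite -linearP; congr (quot_pi _ _); apply: funext => p.
  by rewrite /= [f _]linearP.
by exists (to_linear F_lin).
Qed.

End Functoriality.
End Completion.

(** * Homotopies raising a filtration *)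

Section RaisingHomotopies.
Variables (R : realType) (G : groupType) (chi : real_hom R G) (t : G).
Hypothesis t_gt0 : 0 < chi t.
Local Notation ring := (monoid_ring G).
Local Notation tau := (chi t).

Section Level.
Variables (X : choiceType) (k : X -> nat).

(** The valuation on [Z[G]^(X)] for which the basis element [(g, x)] has value
    [chi g - k x * chi t]. *)
Definition level (r : R) (v : freemod G X) : Prop :=
  supported (fun u => r <= chi u.1 - tau *+ k u.2) v.

Lemma levelU r g x : r <= chi g - tau *+ k x -> level r (fbas g x).
Proof. by move=> rg; apply: supportedU. Qed.

Lemma level_filtration : filtration chi level.
Proof.
split=> [r|r x y|r r' x le_r|x|r g x].
- exact: supported0.
- exact: supportedB.
- by apply: supported_sub => u; apply: le_trans.
- move: x; apply: freemod_ind => [|x y [r1 xr] [r2 yr]|g x].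
  + by exists 0; apply: supported0.
  + exists (Num.min r1 r2); apply: supportedB.
      by apply: supported_sub xr => u; apply: le_trans; rewrite ge_min lexx.
    by apply: supported_sub yr => u; apply: le_trans; rewrite ge_min lexx orbT.
  by exists (chi g - tau *+ k x); apply: levelU.
apply: supported_shift => m y /=; rewrite real_homM => rm.
by rewrite addrC -addrA lerD2l.
Qed.

End Level.

Variables (C : lmodType ring) (X : nat -> choiceType).
Variable d : forall i, {linear freemod G (X i.+1) -> freemod G (X i)}.
Variable e : {linear freemod G (X 0%N) -> C}.
Hypothesis ed : forall x, e (d 0 x) = 0.
Hypothesis dd : forall i x, d i (d i.+1 x) = 0.
Local Notation F := (@Complex _ C (fun i => freemod G (X i)) d e ed dd).

Lemma weight_exists i (k : X i -> nat) (x : X i.+1) :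
  exists l, level k (- (tau *+ l)) (d i (fbas 1%g x)).
Proof.
have [r rP] := ge_ex (level_filtration k) (d i (fbas 1%g x)).
have [l lP] := archimedean_mulrn (- r) t_gt0.
by exists l; apply: (ge_le (level_filtration k) _ rP); rewrite lerNl.
Qed.

(** Weights for which the differential does not lower the valuation.  They are
    multiples of [chi t], so that the sets of elements of valuation at least
    [- c * chi t] are lattices. *)
Fixpoint weight i : X i -> nat :=
  match i with
  | 0 => fun=> 0%N
  | i'.+1 => fun x => projT1 (cid (weight_exists (@weight i') x))
  end.

Local Notation lev i := (level (@weight i)).
Local Notation filt i := (level_filtration (@weight i)).

Lemma level_linear i j (f : {linear freemod G (X i) -> freemod G (X j)}) r0 :
  (forall x, lev j (r0 - tau *+ weight x) (f (fbas 1%g x))) ->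
  forall r v, lev i r v -> lev j (r + r0) (f v).
Proof.
move=> fP r; apply: fsupported_ind => [|v w fv fw|g x /= r_gx].
- by rewrite linear0; apply: supported0.
- by rewrite linearB; apply: supportedB.
rewrite fbas1Z linearZ_LR.
apply: (ge_le (filt j) _ (geZ (filt j) g (fP x))).
by rewrite -addrA [r + r0]addrC lerD2l addrC.
Qed.

Lemma level_d i r v : lev i.+1 r v -> lev i r (d i v).
Proof.
rewrite -[r in X in _ -> X]addr0; apply: level_linear => x; rewrite sub0r.
exact: (projT2 (cid (weight_exists (@weight i) x))).
Qed.

(** The map [1 - d s - s d]. *)
Definition homotopy_defect (s : forall i, {linear freemod G (X i) -> freemod G (X i.+1)})
    i : freemod G (X i) -> freemod G (X i) :=
  match i with
  | 0 => fun v => v - d 0 (s 0%N v)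
  | i'.+1 => fun v => v - d i'.+1 (s i'.+1 v) - s i' (d i' v)
  end.

Lemma homotopy_defect_linear s i : exists f : {linear freemod G (X i) -> freemod G (X i)},
  forall v, f v = homotopy_defect s v.
Proof.
have [idF idFE] := linear_id (freemod G (X i) : lmodType ring).
have [ds dsE] := linear_comp (s i) (d i).
have [f fE] := linear_sub idF ds.
case: i idF idFE ds dsE f fE => [|i] idF idFE ds dsE f fE.
  by exists f => v; rewrite fE dsE idFE.
have [sd sdE] := linear_comp (d i) (s i).
have [g gE] := linear_sub f sd.
by exists g => v; rewrite gE fE sdE dsE idFE.
Qed.

Section Approximation.
Variables (n : nat) (K : groupClosed G).
Hypothesis K_all : K =i predT.
Hypothesis X_fin : forall i, (i <= n)%N -> finite_basis (X i).
Variable s : forall i (A : lmodType ring),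
  (freemod G (X i.+1) -> A) -> freemod G (X i) -> A.
Hypothesis s_contr : contraction chi K n (F := F) s.

Local Notation cpl i := (completion (filt i)).
Local Notation cpl_pi i := (quot_pi (null_submodule (filt i))).
Local Notation iota i := (to_completion (filt i) : freemod G (X i) -> cpl i).

Lemma equivariant_all (V A : lmodType ring) (f : V -> A) :
  equivariant K f <-> linear f.
Proof.
split=> [[fB fZ]|f_lin].
  by apply: equivariant_linear => // k v; apply: fZ; rewrite K_all.
split=> [|k _ v]; first exact: (linearB (to_linear f_lin)).
exact: (linearZ_LR (to_linear f_lin)).
Qed.

Lemma iota_equivariant i : equivariant K (iota i).
Proof. exact/equivariant_all/to_completion_linear. Qed.

Lemma completed_homotopy_exists i : (i <= n)%N ->
  exists S : {linear freemod G (X i) -> cpl i.+1},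
    forall v, S v = s (iota i.+1) v.
Proof.
move=> le_in; have [s_nat _ _] := s_contr; have [s_eqv _ _] := s_nat i le_in.
have /equivariant_all S_lin :=
  s_eqv _ (completion_complete (filt i.+1)) _ (iota_equivariant i.+1).
by exists (to_linear S_lin).
Qed.

(** The contraction applied to the inclusion of [F] into its completion. *)
Definition completed_homotopy i : {linear freemod G (X i) -> cpl i.+1} :=
  if pselect (exists S : {linear freemod G (X i) -> cpl i.+1},
    forall v, S v = s (iota i.+1) v) is left h then projT1 (cid h) else \0.

Lemma completed_homotopyE i v : (i <= n)%N ->
  completed_homotopy i v = s (iota i.+1) v.
Proof.
move=> le_in; rewrite /completed_homotopy; case: pselect => [h|[]].
  exact: (projT2 (cid h)).
exact: completed_homotopy_exists.
Qed.

(** The entries of index [p] of sequences representing the values of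
    [completed_homotopy] on the basis, extended linearly. *)
Definition approx_homotopy (p : nat) i :
    {linear freemod G (X i) -> freemod G (X i.+1)} :=
  ext_free (fun x => val (completed_homotopy i (fbas 1%g x)) p).

Lemma completed_homotopy_approx i v :
  completed_homotopy i v = cpl_pi i.+1 (fun p => approx_homotopy p i v).
Proof.
have a_lin : linear (fun v p => approx_homotopy p i v).
  by move=> a x y; apply: funext => p; rewrite linearP.
have [f fE] := linear_comp (to_linear a_lin) (cpl_pi i.+1).
rewrite -[RHS]fE; apply: linear_free_eq => x.
rewrite fE -[LHS]quot_piK; congr (quot_pi _ _); apply: funext => p.
by rewrite to_linearE ext_free1.
Qed.

(** By naturality the contraction commutes with the differential of the
    completions, so [completed_homotopy] is a homotopy from the inclusion of
    [F] into its completion to zero. *)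
Lemma approx_defect_null i v : (i <= n)%N ->
  null_seq (lev i) (fun p => homotopy_defect (approx_homotopy p) v).
Proof.
have [s_nat s0 sS] := s_contr => le_in.
apply/(quot_pi_eq0 (null_submodule (filt i))).
have [q qE] := completion_map (filt i.+1) (filt i) (@level_d i).
have cpl_c := @completion_complete R G chi.
have iota_q w : iota i (d i w) = q (iota i.+1 w) by rewrite [RHS]qE.
have sq : s (fun w => iota i (d i w)) v = q (completed_homotopy i v).
  have [_ _ nat_i] := s_nat i le_in.
  have iota_e := iota_equivariant i.+1.
  rewrite completed_homotopyE // -[RHS](nat_i _ _ q (cpl_c _ _ _) (cpl_c _ _ _) _ iota_e).
  by congr (s _ _); apply: funext => w; rewrite iota_q.
have qa : q (completed_homotopy i v) =
    cpl_pi i (fun p => d i (approx_homotopy p i v)).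
  by rewrite completed_homotopy_approx qE.
case: i le_in v q qE iota_q sq qa => [|i] le_in v q qE iota_q sq qa.
  rewrite -[X in quot_pi _ X]/((fun=> v) - (fun p => d 0 (approx_homotopy p 0 v))).
  have E := s0 _ (cpl_c _ _ _) _ (iota_equivariant 0).
  by rewrite linearB -qa -sq E subrr.
rewrite -[X in quot_pi _ X]/((fun=> v) - (fun p => d i.+1 (approx_homotopy p i.+1 v))
   - (fun p => approx_homotopy p i (d i v))).
have E := sS i le_in _ (cpl_c _ _ _) _ (iota_equivariant i.+1).
rewrite 2!linearB -qa -sq E.
rewrite -completed_homotopy_approx completed_homotopyE 1?ltnW //.
apply: (etrans (congr1 (+%R^~ _) (subKr (iota i.+1 v : cpl i.+1) _))).
exact: subrr.
Qed.

(** In each degree up to [n] the basis is finite, so that one index [p] serves for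
    all basis elements. *)
Lemma contracting_homotopy :
  exists h : forall i, {linear freemod G (X i) -> freemod G (X i.+1)},
    forall i, (i <= n)%N -> forall r v,
      lev i r v -> lev i (r + 1) (homotopy_defect h v).
Proof.
have p_ex i : exists p0, (i <= n)%N -> forall p, (p0 <= p)%N -> forall x : X i,
    lev i (1 - tau *+ weight x) (homotopy_defect (approx_homotopy p) (fbas 1%g x)).
  have [le_in|_] := leqP i n; last by exists 0%N.
  have p0_ex (x : X i) := approx_defect_null (fbas 1%g x) le_in (1 - tau *+ weight x).
  have [p0 p0P] := choice p0_ex.
  have [l lP] := X_fin le_in; exists (\max_(y <- l) p0 y)%N => _ p le_p x.
  by apply: p0P; apply: leq_trans le_p; apply: leq_bigmax_seq.
have [p0 p0P] := choice p_ex.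
pose p := (\max_(i < n.+1) p0 i)%N.
exists (approx_homotopy p) => i le_in r v.
have [f fE] := homotopy_defect_linear (approx_homotopy p) i.
rewrite -fE; apply: level_linear => x; rewrite fE; apply: p0P => //.
by rewrite /p -[i]/(nat_of_ord (Ordinal (le_in : i < n.+1)%N)); apply: leq_bigmax.
Qed.

End Approximation.
End RaisingHomotopies.

(** * Finiteness over the monoid of a character *)

Section LatticeFiniteness.
Variables (R : realType) (G : groupType) (chi : real_hom R G) (t : G).
Hypothesis t_gt0 : 0 < chi t.
Local Notation tau := (chi t).
Local Notation S := (nonneg_monoid chi).
Variables (X : nat -> choiceType).
Variable d : forall i, {linear freemod G (X i.+1) -> freemod G (X i)}.
Variable e : {linear freemod G (X 0%N) -> trivial_module G}.
Hypothesis ed : forall x, e (d 0 x) = 0.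
Hypothesis dd : forall i x, d i (d i.+1 x) = 0.
Local Notation F :=
  (@Complex _ (trivial_module G) (fun i => freemod G (X i)) d e ed dd).
Local Notation wt i := (@weight _ _ _ _ t_gt0 X d i).
Local Notation lev i := (level chi t (wt i)).
Local Notation filt i := (level_filtration chi t (wt i)).
Variable n : nat.
Hypothesis F_exact : is_exact F.
Hypothesis X_fin : forall i, (i <= n)%N -> finite_basis (X i).
Variable h : forall i, {linear freemod G (X i) -> freemod G (X i.+1)}.
Hypothesis h_contr : forall i, (i <= n)%N -> forall r v,
  lev i r v -> lev i (r + 1) (homotopy_defect d h v).

(** The lattice with these shifts consists of the elements of valuation at least
    [- c * chi t]. *)
Definition lattice_shift c i (x : X i) : G :=
  (t ^+ wt i x * (t ^+ c)^-1)%g.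

Local Notation lat c i := (lattice chi (lattice_shift c (i := i))).

Lemma chi_lattice_shift c i (x : X i) :
  chi (lattice_shift c x) = tau *+ wt i x - tau *+ c.
Proof. by rewrite real_homM real_homV !real_homX. Qed.

Lemma lattice_level c i v : lev i (- (tau *+ c)) (lat c i v).
Proof.
move=> u /(lattice_supported (y := v)).
by rewrite chi_lattice_shift lerBrDr addrC.
Qed.

Lemma level_lattice c i v : lev i (- (tau *+ c)) v -> exists y, lat c i y = v.
Proof.
move=> v_lev; apply: lattice_onto => u /v_lev.
by rewrite chi_lattice_shift lerBrDr addrC.
Qed.

Lemma homotopy_level i : (i <= n)%N ->
  exists r0, forall r v, lev i r v -> lev i.+1 (r + r0) (h i v).
Proof.
move=> le_in.
have [r0 r0P] := ge_common (filt i.+1) (fun x => h i (fbas 1%g x)) (X_fin le_in).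
exists r0; apply: level_linear => x; apply: (ge_le (filt i.+1) _ (r0P x)).
by rewrite gerBl mulrn_wge0 // ltW.
Qed.

(** Replace [v] by [v - d (h v)], which has the same boundary.  It is the sum of
    the defect of [h] at [v], of valuation larger by [1], and of [h (d v)], of
    valuation at least [r + r0].  Repeat until the first term is in this range
    as well. *)
Lemma bounding i r0 : (i < n)%N ->
  (forall r v, lev i r v -> lev i.+1 (r + r0) (h i v)) ->
  forall r v, lev i r (d i v) -> exists2 w, lev i.+1 (r + r0) w & d i w = d i v.
Proof.
move=> lt_in h_lev r v dv_lev.
suff claim m : forall v', d i v' = d i v -> lev i.+1 (r + r0 - m%:R) v' ->
    exists2 w, lev i.+1 (r + r0) w & d i w = d i v.
  have [r1 r1P] := ge_ex (filt i.+1) v.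
  apply: (claim (Num.truncn (r + r0 - r1)).+1 v) => //.
  apply: (ge_le (filt i.+1) _ r1P).
  by rewrite lerBlDr -lerBlDl; apply/ltW/truncnS_gt.
elim: m => [|m IH] v' dv' v'_lev.
  by exists v' => //; rewrite subr0 in v'_lev.
apply: (IH (v' - d i.+1 (h i.+1 v'))).
  by rewrite linearB dd subr0.
have -> : v' - d i.+1 (h i.+1 v') = homotopy_defect d h v' + h i (d i v').
  by rewrite /= subrK.
apply: (geD (filt i.+1)).
  have := h_contr lt_in v'_lev; apply: (ge_le (filt i.+1)).
  by rewrite -[m.+1]addn1 natrD opprD addrA subrK.
rewrite dv'; apply: (ge_le (filt i.+1) _ (h_lev _ _ dv_lev)).
by rewrite gerBl ler0n.
Qed.

Lemma trivial_fin_generated (M : monoidType) :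
  fin_generated (trivial_module M : lmodType (monoid_ring M)).
Proof.
apply/fin_generatedP; exists [:: (1 : trivial_module M)] => z.
have -> : z = (z : int)%:~R *: (1 : trivial_module M) + 0.
  by rewrite addr0 scaler_int; apply/esym/intz.
by apply: SpanD (Span0 _); rewrite inE.
Qed.

(** Brown's criterion for the filtration of the resolution over [Z[G]] by
    lattices. *)
Lemma lattice_syzygies i :
  (i <= n)%N -> fin_generated (syzygy (trivial_module S) i).
Proof.
move=> le_in.
apply: (@syzygies_fin_generated _ (trivial_module S) n
  (restr_complex (nonneg_val_hom chi) F)
  (fun _ i => freemod S (X i)) (fun c i => lat c i)) => //.
- by move=> c j; apply: lattice_inj.
- by move=> _ j _; apply: freemod_projective.
- by move=> _ j le_jn; apply: freemod_fin_generated (X_fin le_jn).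
- move=> c j x; apply: level_lattice.
  exact/level_d/lattice_level.
- move=> c c' j x le_cc'.
  have le_tau : - (tau *+ c') <= - (tau *+ c).
    by rewrite lerN2 -(subnK le_cc') mulrnDr lerDr mulrn_wge0 // ltW.
  exact: level_lattice (ge_le (filt j) le_tau (@lattice_level c j x)).
- move=> j x _; have [r rP] := ge_ex (filt j) x.
  have [c cP] := archimedean_mulrn (- r) t_gt0; exists c; apply: level_lattice.
  by apply: (ge_le (filt j) _ rP); rewrite lerNl.
- move=> j c lt_jn; have [r0 r0P] := homotopy_level (ltnW lt_jn).
  have [c1 c1P] := archimedean_mulrn (tau *+ c - r0) t_gt0.
  exists (maxn c c1); first exact: leq_maxl.
  move=> z z_cyc.
  have [_ ex] := restr_complex_exact (nonneg_val_hom chi) F_exact.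
  have [y yE] : exists y, d j y = lat c j z := ex j _ z_cyc.
  have [|w w_lev wE] := @bounding j r0 lt_jn r0P (- (tau *+ c)) y.
    by rewrite yE; apply: lattice_level.
  have [|w' w'E] := @level_lattice (maxn c c1) _ w.
    apply: (ge_le (filt j.+1) _ w_lev).
    rewrite lerNl opprD opprK (le_trans c1P) //.
    by rewrite -(subnK (leq_maxr c c1)) mulrnDr lerDr mulrn_wge0 // ltW.
  by exists w'; rewrite -yE -wE -w'E.
exact: trivial_fin_generated.
Qed.

End LatticeFiniteness.

(** * Subnormal subgroups *)

Section Subnormal.
Variables (R : realType) (G : groupType) (chi : real_hom R G) (n : nat).
Local Notation F := (free_res (trivial_module G)).

Lemma contraction_ext (K K' : groupClosed G) :
  K =i K' -> (exists s, contraction chi K n (F := F) s) ->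
  exists s, contraction chi K' n (F := F) s.
Proof.
move=> KK' [s [s_nat s0 sS]].
have eqvE (V A : lmodType (monoid_ring G)) (f : V -> A) :
    equivariant K' f <-> equivariant K f.
  by split=> -[fB fZ]; split=> // k kK; apply: fZ; rewrite ?KK' // -KK'.
exists s; split=> [i le_in|A A_c f /eqvE|i lt_in A A_c f /eqvE].
- have [s1 s2 s3] := s_nat i le_in; split=> [A A_c f /eqvE f_e
    |A A_c f g /eqvE f_e /eqvE|A A' q A_c A'_c f /eqvE].
  + exact/eqvE/s1.
  + exact: s2.
  exact: s3.
- exact: s0.
exact: sS.
Qed.

Lemma subnormal_contraction (N : groupClosed G) :
  subnormal N -> (exists s, contraction chi N n (F := F) s) ->
  exists (K : groupClosed G) s, K =i predT /\ contraction chi K n (F := F) s.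
Proof.
move=> [r [K [K0 Kr K_normal]]] N_contr.
have C_contr i : (i <= r)%N -> exists s, contraction chi (K i) n (F := F) s.
  elim: i => [|i IH] le_ir.
    by apply: contraction_ext N_contr => x; rewrite K0.
  have [s s_contr] := IH (ltnW le_ir).
  by eexists; apply: (averaged_contraction (K_normal i le_ir) s_contr).
have [s s_contr] := C_contr r (leqnn r).
by exists (K r), s.
Qed.

End Subnormal.

Section SigmaSubgroup.
Variables (R : realType) (G : groupType) (chi : real_hom R G) (n : nat).
Variables (N : groupClosed G) (psi : real_hom R (subgroup N)) (c : R).
Hypothesis c_gt0 : 0 < c.
Hypothesis chiE : forall g, chi (val g) = c * psi g.
Variable t : subgroup N.
Hypothesis t_gt0 : 0 < psi t.

(** The given character [psi] of the subgroup is a positive multiple of the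
    restriction of [chi], so that both have the same positive elements. *)
Lemma subgroup_contraction :
  monoid_type_FP n (nonneg_monoid psi) ->
  exists s, contraction chi N n (F := free_res (trivial_module G)) s.
Proof.
move=> psi_FP; have fg := type_FP_syzygies psi_FP.
have [phi [phi_chain phi_pos]] := contracting_endomorphism n.+1 t_gt0.
have phi_pos' i x :
    supported (fun u => 0 < chi (val u.1)) (phi i (fbas 1%g x)).
  by apply: supported_sub (phi_pos i x) => u u0; rewrite chiE mulr_gt0.
apply: (base_contraction (P := induced_complex psi) (phi := phi)) => //.
- exact: free_res_exact.
- by move=> i; apply: restr_freemod_projective.
- exact: induced_exact t_gt0.
- by move=> i; apply: freemod_projective.
- move=> i A le_in A_c u.
  exact (@solve_exists _ _ chi N _ (phi i) (syz_basis_finite (fg i le_in))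
    (phi_pos' i) A A_c u).
move=> i A le_in A_c w.
exact (@solve_unique _ _ chi N _ (phi i) (syz_basis_finite (fg i le_in))
  (phi_pos' i) A A_c w).
Qed.

End SigmaSubgroup.

Theorem theorem1p5 (R : realType) (n : nat) (G : groupType)
    (N : groupClosed G) (chi : real_hom R G) :
  (1 <= n)%N ->
  monoid_type_FP n G ->
  monoid_type_FP n (subgroup N) ->
  subnormal N ->
  is_character chi ->
  Sigma n (char_class (restrict N chi)) ->
  Sigma n (char_class chi).
Proof.
move=> _ G_FP _ N_subn chi_char [psi [[g psi_g] psi_FP] psi_class].
exists chi => //; split=> //.
have [c c0 chiE] : char_class psi (restrict N chi).
  by rewrite psi_class; exists 1 => // x; rewrite mul1r.
have [t t0] : exists t, 0 < psi t.
  have [g0|g0|g0] := ltgtP (psi g) 0; last by rewrite g0 eqxx in psi_g.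
    by exists g^-1%g; rewrite real_homV oppr_gt0.
  by exists g.
have [K [s [K_all s_contr]]] :=
  subnormal_contraction N_subn (subgroup_contraction c0 chiE t0 psi_FP).
have chi_t : 0 < chi (val t) by rewrite [chi _]chiE mulr_gt0.
have fin i : (i <= n)%N -> finite_basis (syz_basis (trivial_module G) i).
  by move=> le_in; apply: syz_basis_finite; apply: (type_FP_syzygies G_FP).
have [h hP] := contracting_homotopy chi_t K_all fin s_contr.
apply: type_FP_of_syzygies => i le_in.
exact: (lattice_syzygies (free_res_exact _) fin hP le_in).
Qed.
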